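(* Let $n\ge 1$ and let $K\subset\mathbf{R}^n$ be the simplex with the $n+1$ vertices $P_i=(\underbrace{1,\ldots,1}_{i},0,\ldots,0)$, $0\le i\le n$, that is, $(0,0,\ldots,0),(1,0,\ldots,0),(1,1,0,\ldots,0),\ldots,(1,1,\ldots,1)$. Then for every $1\le k\le n$, $$V_k(K)=\frac{1}{k!}\sum_{(l_1,\ldots,l_k)\in A}\frac{1}{\sqrt{l_1\,l_2\cdots l_k}},$$ where $A$ is the set of integral vectors $(l_1,l_2,\ldots,l_k)$ with $l_i\ge 1$ for $1\le i\le k$ and $\sum_{1\le i\le k} l_i\le n$, and $V_k$ denotes the $k$-th intrinsic volume.
   Context: For a nonempty compact convex set $L\subset\mathbf{R}^n$ with $B_n$ the Euclidean unit ball of $\mathbf{R}^n$, the intrinsic volumes $V_0(L),\dots,V_n(L)$ are defined by the Steiner formula $\mathrm{vol}_n(L+\lambda B_n)=\sum_{j=0}^{n}\lambda^{n-j}\,\omega_{n-j}\,V_j(L)$ for all $\lambda\ge 0$, where $\omega_j=\pi^{j/2}/\Gamma(j/2+1)$ is the volume of the $j$-dimensional unit ball (with $\omega_0=1$). Equivalently, for a polytope $L$, $V_k(L)=\sum_F \mathrm{vol}_k(F)\,\gamma(F)$, where the sum is over the $k$-dimensional faces $F$ of $L$ and $\gamma(F)$ is the standard Gaussian measure, taken within the linear span of the cone, of the normal cone $N(F,L)$ of $L$ at $F$. *)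

(* Defs.v *)
From mathcomp Require Import all_boot all_order all_algebra.
From mathcomp Require Import all_classical all_reals all_analysis.

Set Implicit Arguments.
Unset Strict Implicit.
Unset Printing Implicit Defensive.

Import Order.TTheory GRing.Theory Num.Theory.
Import numFieldNormedType.Exports.

Local Open Scope classical_set_scope.
Local Open Scope ring_scope.

(* The n-fold product of the Lebesgue measure of the line, for the product
   sigma-algebra that n.-tuple carries.  It is R^n-Lebesgue measure on Borel
   sets; it is not meant to be applied to non-Borel sets. *)
Fixpoint tuple_lebesgue (R : realType) (n : nat) :
    set (n.-tuple (measurableTypeR R)) -> \bar R :=
  match n with
  | 0 => \d_ [tuple]
  | m.+1 => pushforward ((@lebesgue_measure R) \x (@tuple_lebesgue R m))%E
              (fun p => [tuple of p.1 :: p.2])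
  end.

Definition vol (R : realType) (n : nat) (A : set 'rV[R]_n) : \bar R :=
  tuple_lebesgue [set t : n.-tuple (measurableTypeR R) |
                   A (\row_(i < n) tnth t i)].

(* The library norm on 'rV[R]_n is the sup norm. *)
Definition enorm (R : realType) (n : nat) (x : 'rV[R]_n) : R :=
  Num.sqrt (\sum_(i < n) x 0 i ^+ 2).

Definition eball (R : realType) (n : nat) : set 'rV[R]_n :=
  [set x | enorm x <= 1].

Definition parallel_body (R : realType) (n : nat) (L : set 'rV[R]_n) (r : R) :
    set 'rV[R]_n :=
  [set x + r *: y | x in L & y in @eball R n].

Definition Gamma (R : realType) (s : R) : R :=
  \int[@lebesgue_measure R]_(t in `]0, +oo[) (t `^ (s - 1) * expR (- t)).

Definition omega (R : realType) (j : nat) : R :=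
  pi `^ (j%:R / 2) / Gamma (j%:R / 2 + 1).

Definition steiner_formula (R : realType) (n : nat) (L : set 'rV[R]_n)
    (V : {ffun 'I_n.+1 -> R}) : Prop :=
  forall r : R, 0 <= r ->
    vol (parallel_body L r) =
    (\sum_(j < n.+1) r ^+ (n - j) * omega R (n - j) * V j)%:E.

(* The Steiner formula determines its coefficients V_0(L), ..., V_n(L); the
   default value [ffun=> 0] is used only when L satisfies no such formula, which
   never happens for L nonempty, compact and convex. *)
Definition intrinsic_volume (R : realType) (n : nat) (L : set 'rV[R]_n)
    (k : 'I_n.+1) : R :=
  xget [ffun=> 0] [set V | steiner_formula L V] k.

Definition conv_hull (R : realType) (n m : nat) (P : 'I_m -> 'rV[R]_n) :
    set 'rV[R]_n :=
  [set x | exists w : 'I_m -> R,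
    [/\ forall i, 0 <= w i, \sum_(i < m) w i = 1
      & x = \sum_(i < m) w i *: P i]].

Definition path_vertex (R : realType) (n : nat) (i : 'I_n.+1) : 'rV[R]_n :=
  \row_(j < n) (j < i)%N%:R.

Definition path_simplex (R : realType) (n : nat) : set 'rV[R]_n :=
  conv_hull (@path_vertex R n).

(* Positive integers with sum at most n are themselves at most n, so 'I_n.+1 is
   large enough to hold the coordinates. *)
Definition index_set (n k : nat) : {set {ffun 'I_k -> 'I_n.+1}} :=
  [set l : {ffun 'I_k -> 'I_n.+1} |
    [forall i, (1 <= l i)%N] && (\sum_(i < k) l i <= n)%N].

(* Main.v *)
(* Write K_n for the simplex of nonincreasing vectors in [0, 1]^n.  The projection
   of x on K_n is obtained from the slopes of the least concave majorant of the
   walk of partial sums of x, clipped to [0, 1]; hence each edge of the majorant,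
   i.e. each block y of consecutive coordinates of x, contributes
   Q y = sum_i (y_i - clip (avg y))^2 to the squared distance, and deleting a block
   turns x into x' with d(x, K_n)^2 = d(x', K_(n-l))^2 + Q y, where l is the length
   of y.  The lengths of the blocks of x sum to n, a block is reinserted in x' at
   the unique place determined by its slope, and among the l rotations of a generic
   y exactly one is a single block.  With F_n s = vol {x | d(x, K_n)^2 <= s} this gives
     n F_n s = sum_(1 <= l <= n) \int_(y in R^l) F_(n-l) (s - Q y) dy,
   and splitting R^l along its diagonal evaluates each term as
     sqrt l (B_(l-1) F_(n-l)) s + (B_l F_(n-l)) s,
   where B_j H s is the integral of H (s - |z|^2) over z in R^j.  Since B_i B_j = B_(i+j),
   F_n is a combination of the functions B_(n-k) F_0, i.e. of volumes of balls, whose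
   coefficients satisfy the same recursion as the right-hand side of the theorem. *)

(* No face and no angle of a normal cone is ever measured. The length weight does double duty:
   summed over the blocks of x it is the constant n, and for one block of length l it is the
   reciprocal of the share of rotations that are single, so the constraint that y be a block
   disappears and y ranges over all of R^l. The two terms per length come from the clipping. If the
   average of y lies in [0, 1], clipping is inactive and the corresponding piece of the diagonal has
   length sqrt l; otherwise the two half-lines that remain once [0, 1] is cut out glue to a full
   line and give back the missing dimension. Uniqueness of the block over an index, and of the
   position for reinsertion, fails on ties among partial sums, so the counting identities are used
   almost everywhere. Points of R^n are sequences because blocks are cut out, reinserted and
   rotated, and the dimension changes at every step. *)
Require Import Defs.
From mathcomp Require Import all_boot all_order all_algebra.
From mathcomp Require Import all_classical all_reals all_analysis.
From mathcomp Require Import measurable_realfun.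
From mathcomp Require Import ring lra zify.

Set Implicit Arguments.
Unset Strict Implicit.
Unset Printing Implicit Defensive.

Import Order.TTheory GRing.Theory Num.Theory.
Import numFieldNormedType.Exports.

Local Open Scope classical_set_scope.
Local Open Scope ring_scope.

(** * Iterated Lebesgue integrals *)

Section line_substitution.
Local Open Scope ereal_scope.
Context {R : realType}.
Local Notation mu := (@lebesgue_measure R).

Lemma ge0_integral_affine (c b : R) (f : R -> \bar R) : (0 < c)%R ->
  measurable_fun [set: R] f -> (forall x, 0 <= f x) ->
  \int[mu]_x f (c * x + b)%R = (c^-1)%:E * \int[mu]_x f x.
Proof.
move=> c0 mf f0.
pose phi (x : R) : measurableTypeR R := (c * x + b)%R.
have mphi : measurable_fun setT phi.
  by apply: measurable_funD => //; exact: measurable_funM.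
pose r := NngNum (ltW c0).
(* Lebesgue measure is determined by its values on half-open intervals, so the scaling factor of the
   pushforward need only be checked there. *)
have muE (A : set (measurableTypeR R)) : measurable A ->
    mu A = mscale r (pushforward mu phi) A.
  move=> mA; apply: lebesgue_measure_unique mA => //= _ [[x y]] _ <- /=.
  rewrite /mscale /pushforward/=.
  rewrite [X in _ * mu X](_ : _ = `]((x - b) / c)%R, ((y - b) / c)%R]%classic); last first.
    apply/seteqP; split => z /=; rewrite !in_itv/= /phi ltr_pdivrMr// ler_pdivlMr//;
      by rewrite ltrBlDr lerBrDr mulrC.
  rewrite !lebesgue_measure_itv/= !lte_fin ltr_pM2r ?invr_gt0// ltrD2r.
  case: ifP => _; last by rewrite mule0.
  by rewrite -EFinB -EFinM; congr EFin; field; rewrite gt_eqF.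
transitivity (\int[pushforward mu phi]_(x in setT) f x).
  by rewrite ge0_integral_pushforward.
have -> : \int[mu]_x f x = c%:E * \int[pushforward mu phi]_x f x.
  rewrite (@eq_measure_integral _ _ _ setT (mscale r (pushforward mu phi)) mu f).
    by rewrite ge0_integral_mscale.
  by move=> A mA _; exact: muE.
by rewrite muleA -EFinM mulVf ?gt_eqF// mul1e.
Qed.

Lemma ge0_integral_shift (b : R) (f : R -> \bar R) :
  measurable_fun [set: R] f -> (forall x, 0 <= f x) ->
  \int[mu]_x f (x + b)%R = \int[mu]_x f x.
Proof.
move=> mf f0; rewrite -[RHS]mul1e -[X in X%:E * _]invr1.
rewrite -(@ge0_integral_affine 1%R b)//.
by apply: eq_integral => x _; rewrite mul1r.
Qed.

Lemma ge0_integral_scale (c : R) (f : R -> \bar R) : (0 < c)%R ->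
  measurable_fun [set: R] f -> (forall x, 0 <= f x) ->
  \int[mu]_x f (c * x)%R = (c^-1)%:E * \int[mu]_x f x.
Proof.
move=> c0 mf f0; rewrite -(@ge0_integral_affine c 0%R)//.
by apply: eq_integral => x _; rewrite addr0.
Qed.

Lemma ge0_integral_swap (f : R -> R -> \bar R) :
  measurable_fun [set: R * R] (fun p => f p.1 p.2) -> (forall x y, 0 <= f x y) ->
  \int[mu]_x \int[mu]_y f x y = \int[mu]_y \int[mu]_x f x y.
Proof.
move=> mf f0.
exact: (@fubini_tonelli _ _ (measurableTypeR R) (measurableTypeR R) R mu mu
  (fun p => f p.1 p.2) mf).
Qed.

End line_substitution.

Section measurable_sequences.
Context {R : realType}.

(* Measurability in a sequence argument is tested on sequences of n measurable
   functions over an arbitrary space, which avoids casts between tuple types. *)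
Definition mseq d (T : measurableType d) (n : nat) (xs : T -> seq R) :=
  (forall t, size (xs t) = n) /\
  (forall i, measurable_fun [set: T] (fun t => nth 0 (xs t) i)).

Section one_space.
Context d (T : measurableType d).
Implicit Types xs ys : T -> seq R.

Lemma mseq_nil : mseq 0 (fun _ : T => [::]).
Proof. by split=> // i; under eq_fun do rewrite nth_nil. Qed.

Lemma mseq_cons n (f : T -> R) xs : measurable_fun [set: T] f -> mseq n xs ->
  mseq n.+1 (fun t => f t :: xs t).
Proof. by move=> mf [sxs mxs]; split=> [t|[|i]]//=; rewrite sxs. Qed.

Lemma mseq_cat m n xs ys : mseq m xs -> mseq n ys ->
  mseq (m + n) (fun t => xs t ++ ys t).
Proof.
move=> [sxs mxs] [sys mys]; split=> [t|i]; first by rewrite size_cat sxs sys.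
have [im|mi] := ltnP i m.
  by under eq_fun do rewrite nth_cat sxs im; exact: mxs.
by under eq_fun do rewrite nth_cat sxs ltnNge mi/=; exact: mys.
Qed.

Lemma mseq_take m n xs : (m <= n)%N -> mseq n xs -> mseq m (fun t => take m (xs t)).
Proof.
move=> mn [sxs mxs]; split=> [t|i]; first by rewrite size_takel// sxs.
have [im|mi] := ltnP i m.
  by under eq_fun do rewrite nth_take//; exact: mxs.
rewrite (_ : (fun t => _) = cst 0); first exact: measurable_cst.
by apply/funext => t; rewrite nth_default// size_takel// sxs.
Qed.

Lemma mseq_drop m n xs : mseq n xs -> mseq (n - m) (fun t => drop m (xs t)).
Proof.
move=> [sxs mxs]; split=> [t|i]; first by rewrite size_drop sxs.
by under eq_fun do rewrite nth_drop; exact: mxs.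
Qed.

Lemma measurable_sum_mseq n xs (f : T -> R -> R) : mseq n xs ->
  (forall i, measurable_fun [set: T] (fun t => f t (nth 0 (xs t) i))) ->
  measurable_fun [set: T] (fun t => \sum_(x <- xs t) f t x).
Proof.
move=> [sxs _] mf.
rewrite (_ : (fun t => _) = (fun t => \sum_(i < n) f t (nth 0 (xs t) i))).
  by apply: measurable_sum.
by apply/funext => t; rewrite (big_nth 0) big_mkord sxs.
Qed.

Lemma measurable_sum_seq n xs : mseq n xs ->
  measurable_fun [set: T] (fun t => \sum_(x <- xs t) x).
Proof.
by move=> mxs; apply: (measurable_sum_mseq (f := fun _ x => x) mxs) => i; apply mxs.2.
Qed.

End one_space.

Lemma mseq_comp d (T : measurableType d) d' (T' : measurableType d') n
    (xs : T -> seq R) (phi : T' -> T) :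
  measurable_fun setT phi -> mseq n xs -> mseq n (xs \o phi).
Proof.
move=> mphi [sxs mxs]; split=> [t|i]; first exact: sxs.
exact: (measurableT_comp (mxs i)).
Qed.

Definition seqmeas n (g : seq R -> \bar R) :=
  forall d (T : measurableType d) (xs : T -> seq R), mseq n xs ->
    measurable_fun [set: T] (fun t => g (xs t)).

(** Joint measurability in a parameter and a sequence, again through test maps: a constant [phi]
    gives the sections, a projection lets the parameter absorb further variables. *)
Definition jmeas d (T : measurableType d) n (h : T -> seq R -> \bar R) :=
  forall d' (T' : measurableType d') (phi : T' -> T) (xs : T' -> seq R),
    measurable_fun setT phi -> mseq n xs ->
    measurable_fun [set: T'] (fun t => h (phi t) (xs t)).

Definition seqmeas2 m n (h : seq R -> seq R -> \bar R) :=
  forall d (T : measurableType d) (xs ys : T -> seq R), mseq m xs -> mseq n ys ->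
    measurable_fun [set: T] (fun t => h (xs t) (ys t)).

Lemma seqmeas_cons n g : seqmeas n.+1 g -> jmeas n (fun (x : R) s => g (x :: s)).
Proof. by move=> mg d T phi xs mphi mxs; apply: mg; exact: mseq_cons. Qed.

Lemma jmeas_seqmeas d (T : measurableType d) n (h : T -> seq R -> \bar R) t :
  jmeas n h -> seqmeas n (h t).
Proof. by move=> mh d' T' xs mxs; apply: (mh _ _ (cst t)). Qed.

End measurable_sequences.

Section iterated_integral.
Local Open Scope ereal_scope.
Context {R : realType}.
Local Notation mu := (@lebesgue_measure R).

(* Lebesgue integral over R^n, with the points of R^n represented as sequences of size n. *)
Fixpoint iint (n : nat) (g : seq R -> \bar R) : \bar R :=
  if n is m.+1 then \int[mu]_x iint m (fun s => g (x :: s)) else g [::].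

Lemma iintS n g : iint n.+1 g = \int[mu]_x iint n (fun s => g (x :: s)).
Proof. by []. Qed.

Lemma eq_iint n g g' : (forall s, size s = n -> g s = g' s) ->
  iint n g = iint n g'.
Proof.
elim: n g g' => [|n IH] g g' gg' /=; first exact: gg'.
by apply: eq_integral => x _; apply: IH => s sn; apply: gg'; rewrite /= sn.
Qed.

Lemma iint_ge0 n g : (forall s, 0 <= g s) -> 0 <= iint n g.
Proof.
elim: n g => [|n IH] g g0 //=.
by apply: integral_ge0 => x _; exact: IH.
Qed.

Lemma iint_cat m n g :
  iint (m + n) g = iint m (fun x => iint n (fun y => g (x ++ y))).
Proof.
by elim: m g => [|m IH] g //=; apply: eq_integral => x _; rewrite IH.
Qed.

(** The induction generalises over the parameter space: the first coordinate joins the parameter in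
    [T * R], and Tonelli then integrates it out. *)
Lemma measurable_iint n d (T : measurableType d) (h : T -> seq R -> \bar R) :
  (forall t s, 0 <= h t s) -> jmeas n h ->
  measurable_fun [set: T] (fun t => iint n (h t)).
Proof.
elim: n d T h => [|n IH] d T h h0 mh /=.
  exact: (mh _ _ idfun (fun=> [::]) (@measurable_id _ _ _) (mseq_nil _)).
pose H (p : T * R) := iint n (fun s => h p.1 (p.2 :: s)).
have mH : measurable_fun setT H.
  apply: IH => // d' T' phi xs mphi mxs.
  apply: (mh _ _ (fun t => (phi t).1)).
    exact: (measurableT_comp measurable_fst).
  by apply: mseq_cons => //; exact: (measurableT_comp measurable_snd).
have := @measurable_fun_fubini_tonelli_F _ _ T (measurableTypeR R) R mu H mH.
by apply=> p; exact: iint_ge0.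
Qed.

Lemma measurable_iint_cons n g : (forall s, 0 <= g s) -> seqmeas n.+1 g ->
  measurable_fun [set: R] (fun x => iint n (fun s => g (x :: s))).
Proof. by move=> g0 mg; apply: measurable_iint => //; exact: seqmeas_cons. Qed.

Lemma iintD n g g' : (forall s, 0 <= g s) -> (forall s, 0 <= g' s) ->
  seqmeas n g -> seqmeas n g' ->
  iint n (fun s => g s + g' s) = iint n g + iint n g'.
Proof.
elim: n g g' => [|n IH] g g' g0 g'0 mg mg' //=.
rewrite -ge0_integralD//.
- apply: eq_integral => x _; apply: IH => //.
  + exact: jmeas_seqmeas (seqmeas_cons mg).
  + exact: jmeas_seqmeas (seqmeas_cons mg').
- by move=> x _; exact: iint_ge0.
- exact: measurable_iint_cons.
- by move=> x _; exact: iint_ge0.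
- exact: measurable_iint_cons.
Qed.

Lemma seqmeas_sum n I (r : seq I) (g : I -> seq R -> \bar R) :
  (forall i, seqmeas n (g i)) -> seqmeas n (fun s => \sum_(i <- r) g i s).
Proof. by move=> mg d T xs mxs; apply: emeasurable_sum => i; exact: mg. Qed.

Lemma iint_sum n I (r : seq I) (g : I -> seq R -> \bar R) :
  (forall i s, 0 <= g i s) -> (forall i, seqmeas n (g i)) ->
  iint n (fun s => \sum_(i <- r) g i s) = \sum_(i <- r) iint n (g i).
Proof.
move=> g0 mg; elim: r => [|i r IH].
  rewrite big_nil; under eq_iint do rewrite big_nil.
  by elim: n {mg} => [|n IH] //=; rewrite integral0_eq.
rewrite big_cons -IH; under eq_iint do rewrite big_cons.
rewrite iintD//.
- by move=> s; exact: sume_ge0.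
- exact: seqmeas_sum.
Qed.

Lemma iintZl n g (c : R) : (0 <= c)%R -> (forall s, 0 <= g s) ->
  seqmeas n g -> iint n (fun s => c%:E * g s) = c%:E * iint n g.
Proof.
move=> c0; elim: n g => [|n IH] g g0 mg //=.
rewrite -ge0_integralZl_EFin//.
- apply: eq_integral => x _; apply: IH => //.
  exact: jmeas_seqmeas (seqmeas_cons mg).
- by move=> x _; exact: iint_ge0.
- exact: measurable_iint_cons.
Qed.

Lemma seqmeasZl n g (c : R) : seqmeas n g -> seqmeas n (fun s => c%:E * g s).
Proof. by move=> mg d T xs mxs; apply: measurable_funeM; exact: mg. Qed.

Lemma integral_iint n (h : R -> seq R -> \bar R) : (forall x s, 0 <= h x s) ->
  jmeas n h ->
  \int[mu]_x iint n (h x) = iint n (fun s => \int[mu]_x h x s).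
Proof.
elim: n h => [|n IH] h h0 mh //=.
pose H (p : R * R) := iint n (fun s => h p.1 (p.2 :: s)).
have mH : measurable_fun setT H.
  apply: measurable_iint => // d T phi xs mphi mxs.
  apply: (mh _ _ (fun t => (phi t).1)).
    exact: (measurableT_comp measurable_fst).
  by apply: mseq_cons => //; exact: (measurableT_comp measurable_snd).
rewrite (ge0_integral_swap mH); last by move=> x y; exact: iint_ge0.
apply: eq_integral => z _; rewrite /H/= IH// => d T phi xs mphi mxs.
by apply: mh => //; exact: mseq_cons.
Qed.

Lemma jmeas_integral n (h : R -> seq R -> \bar R) : (forall x s, 0 <= h x s) ->
  jmeas n h -> seqmeas n (fun s => \int[mu]_x h x s).
Proof.
move=> h0 mh d T xs mxs.
have := @measurable_fun_fubini_tonelli_F _ _ T (measurableTypeR R) R mu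
  (fun p => h p.2 (xs p.1)).
apply=> //; apply: (mh _ _ snd (xs \o fst)) => //.
exact: mseq_comp.
Qed.

Lemma iint_swap m n (h : seq R -> seq R -> \bar R) : (forall x y, 0 <= h x y) ->
  seqmeas2 m n h ->
  iint m (fun x => iint n (h x)) = iint n (fun y => iint m (h ^~ y)).
Proof.
elim: m h => [|m IH] h h0 mh //=.
rewrite -integral_iint.
- apply: eq_integral => x _; rewrite IH// => d T xs ys mxs mys.
  by apply: mh => //; exact: mseq_cons.
- by move=> x y; exact: iint_ge0.
- move=> d T phi ys mphi mys.
  apply: measurable_iint => // d' T' psi xs mpsi mxs.
  apply: mh; last exact: mseq_comp.
  by apply: mseq_cons => //; exact: measurableT_comp.
Qed.

End iterated_integral.

Section iterated_ae.
Local Open Scope ereal_scope.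
Context {R : realType}.
Local Notation mu := (@lebesgue_measure R).

#[global] Instance filter_ae_lebesgue : Filter (almost_everywhere mu).
Proof. exact: (@ae_filter_ringOfSetsType _ (measurableTypeR R) R mu). Qed.

(* Lebesgue-almost everywhere in R^n, in the iterated (Fubini) sense. *)
Fixpoint iae (n : nat) (P : seq R -> Prop) : Prop :=
  if n is m.+1 then {ae mu, forall x, iae m (fun s => P (x :: s))} else P [::].

Lemma iaeW n (P Q : seq R -> Prop) : (forall s, size s = n -> P s -> Q s) ->
  iae n P -> iae n Q.
Proof.
elim: n P Q => [|n IH] P Q PQ /=; first exact: PQ.
by apply: filterS => x; apply: IH => s sn; apply: PQ; rewrite /= sn.
Qed.

Lemma iaeT n (P : seq R -> Prop) : (forall s, size s = n -> P s) -> iae n P.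
Proof.
elim: n P => [|n IH] P HP /=; first exact: HP.
by apply: aeW => x; apply: IH => s sn; apply: HP; rewrite /= sn.
Qed.

Lemma iaeI n (P Q : seq R -> Prop) : iae n P -> iae n Q ->
  iae n (fun s => P s /\ Q s).
Proof.
elim: n P Q => [|n IH] P Q /=; first by [].
by apply: filterS2 => x; exact: IH.
Qed.

Lemma iae_all n (I : eqType) (r : seq I) (P : I -> seq R -> Prop) :
  (forall i, i \in r -> iae n (P i)) -> iae n (fun s => forall i, i \in r -> P i s).
Proof.
elim: r => [|i r IH] HP; first exact: iaeT.
have Pr : iae n (fun s => forall j, j \in r -> P j s).
  by apply: IH => j jr; apply: HP; rewrite inE jr orbT.
have := iaeI (HP i (mem_head _ _)) Pr.
by apply: iaeW => s sn [Pi {}Pr] j /[!inE] /predU1P[->|/Pr].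
Qed.

Lemma eq_iint_ae n g g' : (forall s, 0 <= g s) -> (forall s, 0 <= g' s) ->
  seqmeas n g -> seqmeas n g' -> iae n (fun s => g s = g' s) -> iint n g = iint n g'.
Proof.
elim: n g g' => [|n IH] g g' g0 g'0 mg mg' //= gg'.
apply: ge0_ae_eq_integral => //.
- exact: measurable_iint_cons.
- exact: measurable_iint_cons.
- by move=> x _; exact: iint_ge0.
- by move=> x _; exact: iint_ge0.
- apply: filterS gg' => x gg' _; apply: IH => //.
  + exact: jmeas_seqmeas (seqmeas_cons mg).
  + exact: jmeas_seqmeas (seqmeas_cons mg').
Qed.

Lemma ae_neq (r : R) : {ae mu, forall x, x <> r}.
Proof.
exists [set r]; split => //; first exact: lebesgue_measure_set1.
by move=> x /= /contrapT.
Qed.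

(** If a later coefficient is nonzero, every section avoids a hyperplane of lower dimension;
    otherwise only one value of the first coordinate is forbidden. *)
Lemma iae_hyperplane n (c : nat -> R) (b : R) : (exists2 i, (i < n)%N & c i != 0%R) ->
  iae n (fun s => \sum_(i < n) c i * s`_i != b)%R.
Proof.
elim: n c b => [|n IH] c b; first by case.
move=> [i]; have [[j jn cj]|nc] := pselect (exists2 i, (i < n)%N & c i.+1 != 0%R).
  move=> _ _ /=; apply: aeW => x.
  have := IH (fun i => c i.+1) (b - c 0%N * x)%R (ex_intro2 _ _ j jn cj).
  by apply: iaeW => s _; apply: contra => /eqP <-; rewrite big_ord_recl/= addrAC subrr add0r.
case: i => [|i] ci; last by move=> ci1; case: nc; exists i.
move=> c0 /=; apply: filterS (ae_neq (b / c 0%N)) => x xb.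
apply: iaeT => s sn; rewrite big_ord_recl/= big1 ?addr0 => [|j _].
  by apply/eqP => cxb; apply: xb; rewrite -cxb mulrC mulKf.
have [->|cj] := eqVneq (c (bump 0 j)) 0%R; first by rewrite mul0r.
by case: nc; exists j.
Qed.

End iterated_ae.

(** * Distance to the simplex and blocks *)

Section block_removal.
Context {R : realFieldType}.
Implicit Types (x y u v w k : seq R) (a c s : R).

Definition psum x j : R := \sum_(z <- take j x) z.
Definition avg x : R := (\sum_(z <- x) z) / (size x)%:R.
Definition clip a : R := Num.max 0 (Num.min 1 a).
(* For a single block y, the squared distance to the constant vectors with value in [0, 1]. *)
Definition clip_cost y : R := \sum_(z <- y) (z - clip (avg y)) ^+ 2.

Definition monotone01 k := pairwise >=%R k && all (fun z => 0 <= z <= 1) k.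
Definition cost x k : R := \sum_(p <- zip x k) (p.1 - p.2) ^+ 2.
(* The squared distance from x to the simplex of nonincreasing sequences in [0, 1]
   is at most s; s may be negative. *)
Definition near_simplex x s :=
  exists k, [/\ size k = size x, monotone01 k & cost x k <= s].

Lemma clip_ge0 a : 0 <= clip a.
Proof. by rewrite /clip le_max lexx. Qed.

Lemma clip_le1 a : clip a <= 1.
Proof. by rewrite /clip ge_max ler01 ge_min lexx. Qed.

Lemma psum0 x : psum x 0 = 0.
Proof. by rewrite /psum take0 big_nil. Qed.

Lemma psum_size x : psum x (size x) = \sum_(z <- x) z.
Proof. by rewrite /psum take_size. Qed.

Lemma psum_cons z x j : psum (z :: x) j.+1 = z + psum x j.
Proof. by rewrite /psum/= big_cons. Qed.

Lemma psum_catl x y j : (j <= size x)%N -> psum (x ++ y) j = psum x j.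
Proof. by move=> jx; rewrite /psum takel_cat. Qed.

Lemma psum_catr x y j : psum (x ++ y) (size x + j) = \sum_(z <- x) z + psum y j.
Proof. by rewrite /psum takeD take_size_cat// drop_size_cat// big_cat. Qed.

Lemma psum_drop x l j : psum (drop l x) j = psum x (l + j) - psum x l.
Proof. by rewrite /psum takeD big_cat/= addrAC subrr add0r. Qed.

Lemma psum_take x l j : (j <= l)%N -> psum (take l x) j = psum x j.
Proof. by move=> jl; rewrite /psum take_takel. Qed.

Lemma sum_drop x j : \sum_(z <- drop j x) z = \sum_(z <- x) z - psum x j.
Proof. by rewrite -[X in _ = \sum_(z <- X) z - _](cat_take_drop j x) big_cat/= addrAC subrr add0r. Qed.

Lemma avgE y : (0 < size y)%N -> avg y * (size y)%:R = \sum_(z <- y) z.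
Proof. by move=> y0; rewrite /avg divfK// pnatr_eq0 -lt0n. Qed.

Lemma cost_cat x y k k' : size x = size k ->
  cost (x ++ y) (k ++ k') = cost x k + cost y k'.
Proof. by move=> xk; rewrite /cost zip_cat// big_cat. Qed.

(** Abel summation: a nonincreasing nonnegative [k] is a nonnegative combination of indicators of
    initial segments, on each of which [y - a] sums to at most [c]. The slack [c] and the bound [b0]
    are there for the induction: after an entry [z] they become [c + a - z] and [k1]. *)
Lemma abel_dec a c (b0 : R) y k : size k = size y -> 0 <= c -> 0 <= b0 ->
  all (<= b0) k -> pairwise >=%R k -> all (>= 0) k ->
  (forall j, (j <= size y)%N -> psum y j <= a * j%:R + c) ->
  \sum_(p <- zip y k) (p.1 - a) * p.2 <= c * b0.
Proof.
elim: y k c b0 => [|z y IH] [|k1 k] c b0//=.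
  by move=> _ c0 b00 *; rewrite big_nil mulr_ge0.
move=> [sk] c0 b00 /andP[k10 _] /andP[kk1 dk] /andP[k1_ge0 k_ge0] Hy.
have := Hy 1%N isT; rewrite psum_cons psum0 addr0 mulr1 => z1.
have {}IH : \sum_(p <- zip y k) (p.1 - a) * p.2 <= (c + a - z) * k1.
  apply: IH => //; first by rewrite subr_ge0 addrC.
  move=> j jy; have := Hy j.+1 jy; rewrite psum_cons -natr1 => H; lra.
rewrite big_cons/=; have : c * k1 <= c * b0 by apply: ler_wpM2l.
by lra.
Qed.

(** The mirror image of [abel_dec]: a nondecreasing [d] is built from indicators of final segments,
    and these have average at least [a]. *)
Lemma abel_inc a d0 u d : size d = size u -> 0 <= d0 ->
  all (>= d0) d -> pairwise <=%R d ->
  (forall j, (j <= size u)%N ->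
    a * (size u - j)%:R <= \sum_(z <- u) z - psum u j) ->
  d0 * (\sum_(z <- u) z - a * (size u)%:R) <= \sum_(p <- zip u d) (p.1 - a) * p.2.
Proof.
elim: u d d0 => [|z u IH] [|d1 d] d0//=.
  by move=> *; rewrite !big_nil mulr0 subrr mulr0.
move=> [sd] d0_ge0 /andP[d01 _] /andP[dd1 dd] Hu.
have Hu0 := Hu 0%N isT.
have {}IH : d1 * (\sum_(z <- u) z - a * (size u)%:R) <=
    \sum_(p <- zip u d) (p.1 - a) * p.2.
  apply: IH => //; first exact: le_trans d01.
  by move=> j ju; have := Hu j.+1 ju; rewrite psum_cons big_cons subSS => H; lra.
move: Hu0; rewrite !big_cons/= psum0 subr0 subn0 -natr1.
move: IH; set S := \sum_(_ <- _) _; set P := \sum_(_ <- _) _ => IH Hu0.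
have : d0 * (z + S - a * ((size u)%:R + 1)) <= d1 * (z + S - a * ((size u)%:R + 1)).
  by apply: ler_wpM2r => //; lra.
by move=> H; apply: (le_trans H); rewrite !mulrBr !mulrDr in IH *; lra.
Qed.

(** The product equals (a - k)^2 - (a - clip a)^2, and [clip a] is the point of [0, 1] nearest to
    [a]. *)
Lemma clip_best a (k : R) : 0 <= k <= 1 -> 0 <= (clip a - k) * (2 * a - k - clip a).
Proof.
move=> /andP[k0 k1]; rewrite /clip.
case: (leP 1 a) => a1; last case: (leP 0 a) => a0.
- by rewrite (max_idPr ler01); apply: mulr_ge0; lra.
- by rewrite (_ : 2 * a - k - a = a - k) -?expr2 ?sqr_ge0//; lra.
- by rewrite -mulrNN; apply: mulr_ge0; lra.
Qed.

(** Raising [k] to [clip a] does not move it away from [a]: with d the increase, (a - k)^2 - (a - k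
    - d)^2 = 2 (a - k) d - d^2. *)
Lemma clip_raise a (k : R) : 0 <= k ->
  (Num.max (clip a) k - k) ^+ 2 <= 2 * (a - k) * (Num.max (clip a) k - k).
Proof.
move=> k0; case: (leP (clip a) k) => ck; first by rewrite subrr expr2 !mulr0.
rewrite expr2; apply: ler_wpM2r; first lra.
move: ck; rewrite /clip; case: (leP 1 a) => a1; last case: (leP 0 a) => a0.
- by rewrite (max_idPr ler01); lra.
- by lra.
- by lra.
Qed.

Lemma clip_lower a (k : R) : k <= 1 ->
  (k - Num.min (clip a) k) ^+ 2 <= 2 * (k - a) * (k - Num.min (clip a) k).
Proof.
move=> k1; case: (ltP (clip a) k) => ck; last by rewrite subrr expr2 !mulr0.
rewrite expr2; apply: ler_wpM2r; first lra.
move: ck; rewrite /clip; case: (leP 1 a) => a1; last case: (leP 0 a) => a0.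
- by rewrite (max_idPr ler01); lra.
- by lra.
- by lra.
Qed.

Lemma cost_nseq y c : cost y (nseq (size y) c) = \sum_(z <- y) (z - c) ^+ 2.
Proof.
rewrite /cost; elim: y => [|z y IH] /=; first by rewrite !big_nil.
by rewrite !big_cons IH.
Qed.

Lemma sum_zip1 y k (f : R -> R) : size k = size y ->
  \sum_(p <- zip y k) f p.1 = \sum_(z <- y) f z.
Proof.
elim: y k => [|z y IH] [|k1 k]//=; first by rewrite !big_nil.
by move=> [sk]; rewrite !big_cons IH.
Qed.

Lemma clip_cost_le y k : (0 < size y)%N -> size k = size y -> monotone01 k ->
  (forall j, (j <= size y)%N -> psum y j <= avg y * j%:R) ->
  clip_cost y <= cost y k.
Proof.
move=> y0 sk /andP[dk k01] Hy.
have H1 : \sum_(p <- zip y k) (p.1 - avg y) * p.2 <= 0.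
  rewrite -[leRHS](mul0r 1); apply: abel_dec => //.
  - by apply: sub_all k01 => z /andP[].
  - by apply: sub_all k01 => z /andP[].
  - by move=> j jy; rewrite addr0; exact: Hy.
have H2 : \sum_(p <- zip y k) (p.1 - avg y) = 0.
  rewrite (sum_zip1 (fun z => z - avg y))// big_split/= -avgE//.
  by rewrite sumrN big_const_seq count_predT iter_addr_0 mulr_natr subrr.
rewrite /clip_cost -(sum_zip1 (fun z => (z - clip (avg y)) ^+ 2) sk).
set a := avg y in H1 H2 *; set c := clip a.
rewrite -subr_ge0 /cost -sumrB.
(* The difference of squares is expanded around the average [a]: the first summand adds up to zero,
   the second is controlled by Abel summation, the third by [clip_best]. *)
rewrite (_ : \sum_(p <- _) _ = \sum_(p <- zip y k)
    (2 * c * (p.1 - a) + ((-2) * ((p.1 - a) * p.2) + (c - p.2) * (2 * a - p.2 - c)))).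
  rewrite !big_split/= -!mulr_sumr H2 mulr0 add0r; apply: addr_ge0; first by lra.
  rewrite big_seq; apply: sumr_ge0 => p /(map_f snd).
  rewrite [map _ _]unzip2_zip ?sk// => pk.
  by apply: clip_best; exact: (allP k01).
by apply: eq_bigr => p _; ring.
Qed.

(** Smaller entries are raised more, so the increments of the nonincreasing [k] are nondecreasing
    and [abel_inc] applies with [d0 = 0]; what remains is entrywise and is [clip_raise]. *)
Lemma cost_raise a u k : size k = size u -> all (>= 0) k -> pairwise >=%R k ->
  (forall j, (j <= size u)%N ->
    a * (size u - j)%:R <= \sum_(z <- u) z - psum u j) ->
  cost u (map (Num.max (clip a)) k) <= cost u k.
Proof.
move=> sk k0 dk Hu.
pose d := [seq Num.max (clip a) z - z | z <- k].
have H : 0 <= \sum_(p <- zip u d) (p.1 - a) * p.2.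
  rewrite -[leLHS](mul0r (\sum_(z <- u) z - a * (size u)%:R)); apply: abel_inc => //.
  - by rewrite size_map.
  - by rewrite all_map; apply/allP => z _ /=; rewrite subr_ge0 le_max lexx orbT.
  - rewrite pairwise_map; apply: sub_pairwise dk => z z' /= zz'.
    by case: (leP (clip a) z); case: (leP (clip a) z'); lra.
rewrite -subr_ge0.
suff -> : cost u k - cost u (map (Num.max (clip a)) k) =
    2 * (\sum_(p <- zip u d) (p.1 - a) * p.2) +
    \sum_(b <- k) (2 * (a - b) * (Num.max (clip a) b - b) - (Num.max (clip a) b - b) ^+ 2).
  apply: addr_ge0; first lra.
  rewrite big_seq; apply: sumr_ge0 => b bk; rewrite subr_ge0.
  by apply: clip_raise; exact: (allP k0).
rewrite /cost /d; elim: u k sk {d H Hu k0 dk} => [|z u IH] [|b k]//=.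
  by rewrite !big_nil; lra.
by move=> [sk]; have := IH _ sk; rewrite !big_cons/= => {}IH; lra.
Qed.

Lemma cost_lower a v k : size k = size v -> all (fun z => z <= 1) k ->
  pairwise >=%R k ->
  (forall j, (j <= size v)%N -> psum v j <= a * j%:R) ->
  cost v (map (Num.min (clip a)) k) <= cost v k.
Proof.
move=> sk k1 dk Hv.
pose d := [seq z - Num.min (clip a) z | z <- k].
have d_ge0 z : 0 <= z - Num.min (clip a) z by rewrite subr_ge0 ge_min lexx orbT.
have H : \sum_(p <- zip v d) (p.1 - a) * p.2 <= 0.
  rewrite -[leRHS](mul0r 1); apply: abel_dec => //.
  - by rewrite size_map.
  - rewrite all_map; apply/allP => z zk /=.
    have := allP k1 _ zk; have := clip_ge0 a; case: (leP (clip a) z); lra.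
  - rewrite pairwise_map; apply: sub_pairwise dk => z z' /= zz'.
    by case: (leP (clip a) z); case: (leP (clip a) z'); lra.
  - by rewrite all_map; apply/allP => z _ /=.
  - by move=> j jv; rewrite addr0; exact: Hv.
rewrite -subr_ge0.
suff -> : cost v k - cost v (map (Num.min (clip a)) k) =
    (-2) * (\sum_(p <- zip v d) (p.1 - a) * p.2) +
    \sum_(b <- k) (2 * (b - a) * (b - Num.min (clip a) b) - (b - Num.min (clip a) b) ^+ 2).
  apply: addr_ge0; first lra.
  rewrite big_seq; apply: sumr_ge0 => b bk; rewrite subr_ge0.
  by apply: clip_lower; exact: (allP k1).
rewrite /cost /d; elim: v k sk {d H Hv k1 dk} => [|z v IH] [|b k]//=.
  by rewrite !big_nil; lra.
by move=> [sk]; have := IH _ sk; rewrite !big_cons/= => {}IH; lra.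
Qed.

(* Removing a block y: for the converse, the distance does not increase when the
   coordinates before y are raised to, and those after y lowered to, the clipped
   average of y (Abel summation against the walk). *)
Lemma near_simplex_remove u y v s : (0 < size y)%N ->
  (forall j, (j <= size u)%N ->
    avg y * (size u - j)%:R <= \sum_(z <- u) z - psum u j) ->
  (forall j, (j <= size y)%N -> psum y j <= avg y * j%:R) ->
  (forall j, (j <= size v)%N -> psum v j <= avg y * j%:R) ->
  near_simplex (u ++ y ++ v) s <-> near_simplex (u ++ v) (s - clip_cost y).
Proof.
move=> y0 Hu Hy Hv; split=> -[k [sk /andP[dk k01] ks]].
  (* In this direction it is enough to delete from [k] the entries facing [y]; they cost at least
     [clip_cost y]. *)
  pose ku := take (size u) k; pose ky := take (size y) (drop (size u) k).
  pose kv := drop (size y) (drop (size u) k).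
  move: sk; rewrite !size_cat => sk.
  have kE : k = ku ++ ky ++ kv by rewrite /ku /ky /kv !cat_take_drop.
  have su : size ku = size u by rewrite size_takel// sk leq_addr.
  have sy : size ky = size y by rewrite size_takel// size_drop sk addKn leq_addr.
  have sv : size kv = size v by rewrite !size_drop sk !addKn.
  have sub : subseq (ku ++ kv) k.
    by rewrite kE; apply: cat_subseq => //; exact: suffix_subseq.
  exists (ku ++ kv); split.
  - by rewrite !size_cat su sv.
  - apply/andP; split; first exact: (subseq_pairwise sub).
    by apply/allP => z /(mem_subseq sub); exact: (allP k01).
  - rewrite cost_cat//.
    have : clip_cost y <= cost y ky.
      apply: clip_cost_le => //; apply/andP; split.
        apply: subseq_pairwise dk; rewrite kE.
        by apply: subseq_trans (suffix_subseq _ _); exact: prefix_subseq.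
      by apply/allP => z zk; apply: (allP k01); rewrite kE !mem_cat zk orbT.
    by move: ks; rewrite kE !cost_cat//; lra.
pose ku := take (size u) k; pose kv := drop (size u) k.
move: sk; rewrite !size_cat => sk.
have kE : k = ku ++ kv by rewrite cat_take_drop.
have su : size ku = size u by rewrite size_takel// sk leq_addr.
have sv : size kv = size v by rewrite !size_drop sk !addKn.
move: dk k01 ks; rewrite kE pairwise_cat all_cat cost_cat//.
move=> /and3P[kuv du dv] /andP[u01 v01] ks.
set a := avg y in Hu Hy Hv ks *.
have Cu := cost_raise su _ du Hu.
have Cv := cost_lower sv _ dv Hv.
have c0 := clip_ge0 a; have c1 := clip_le1 a.
exists (map (Num.max (clip a)) ku ++ nseq (size y) (clip a) ++ map (Num.min (clip a)) kv).
split.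
- by rewrite !size_cat !size_map size_nseq su sv.
- apply/andP; split.
    rewrite !pairwise_cat; apply/and5P; split.
    + apply/allrelP => _ z /mapP[b bk ->]; rewrite mem_cat => /orP[/nseqP[-> _]|/mapP[b' _ ->]].
        by rewrite /= le_max lexx.
      by rewrite /= le_max ge_min lexx.
    + rewrite pairwise_map; apply: sub_pairwise du => z z' /= zz'.
      by case: (leP (clip a) z); case: (leP (clip a) z'); lra.
    + apply/allrelP => _ z /nseqP[-> _] /mapP[b' _ ->].
      by rewrite /= ge_min lexx.
    + elim: (size y) => //= m ->; rewrite andbT; apply/allP => z /nseqP[-> _] /=.
      exact: lexx.
    + rewrite pairwise_map; apply: sub_pairwise dv => z z' /= zz'.
      by case: (leP (clip a) z); case: (leP (clip a) z'); lra.
  rewrite !all_cat !all_map; apply/and3P; split.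
  + apply/allP => z zk /=; have /andP[z0 z1] := allP u01 _ zk.
    by rewrite le_max c0/= ge_max c1.
  + by apply/allP => z /nseqP[-> _]; rewrite c0.
  + apply/allP => z zk /=; have /andP[z0 z1] := allP v01 _ zk.
    by rewrite le_min c0 z0/= ge_min c1.
- rewrite !cost_cat ?size_map ?size_nseq// cost_nseq.
  have {}Cu := Cu (sub_all (fun z => fun H => proj1 (andP H)) u01).
  have {}Cv := Cv (sub_all (fun z => fun H => proj2 (andP H)) v01).
  by move: ks; rewrite /clip_cost; lra.
Qed.

End block_removal.

(** * Edges of the least concave majorant of a walk *)

Section concave_majorant.
Context {R : realFieldType}.
Implicit Types (S : nat -> R) (n : nat).

Definition slope S p q : R := (S q - S p) / (q%:R - p%:R).

(* The chord of the walk S from p to q is an edge of its least concave majorant on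
   [0, n], and no other point of the walk lies on it. *)
Definition above S n p q :=
  forall j, (j <= n)%N -> j != p -> j != q ->
    S j - slope S p q * j%:R < S p - slope S p q * p%:R.

Lemma slopeE S p q : (p < q)%N -> S q - slope S p q * q%:R = S p - slope S p q * p%:R.
Proof.
move=> pq; rewrite /slope; field.
by rewrite subr_eq0 eqr_nat gtn_eqF.
Qed.

Lemma exists_above S n :
  (forall i j k, (i < j)%N -> (j < k)%N -> (k <= n)%N ->
    slope S i j != slope S i k) ->
  forall i, (i < n)%N -> exists p q, [/\ (p <= i)%N, (i < q)%N, (q <= n)%N & above S n p q].
Proof.
move=> gen i i_lt_n.
(* Walk along the vertices m of the majorant: every chord ending at m is steeper
   than every chord starting at m. *)
suff H d m : (n - m <= d)%N -> (m <= i)%N ->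
    (forall q j, (m < q <= n)%N -> (j < m)%N ->
      S j - slope S m q * j%:R < S m - slope S m q * m%:R) ->
    exists p q, [/\ (p <= i)%N, (i < q)%N, (q <= n)%N & above S n p q].
  by apply: (H n 0%N) => //; rewrite subn0.
elim: d m => [|d IH] m md mi Hm.
  by move: md; rewrite leqn0 subn_eq0 leqNgt (leq_ltn_trans mi i_lt_n).
have mn : (m < n)%N by exact: leq_ltn_trans i_lt_n.
have m1 : (m < Ordinal (ltnSn n))%N by [].
(* Gift wrapping: the next vertex ends the steepest chord leaving [m], and [gen] makes it strictly
   the steepest. *)
pose q := [arg max_(q > Ordinal (ltnSn n) | (m < q)%N) slope S m q]%O.
have [q_gt q_max] : (m < q)%N /\
    forall j : 'I_n.+1, (m < j)%N -> slope S m j <= slope S m q.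
  by rewrite /q; case: arg_maxP => // q' ? H; split => // j /H.
have qn : (q <= n)%N by rewrite -ltnS.
set a := slope S m q in q_max *.
have strict j : (j <= n)%N -> (m < j)%N -> j != q -> S j - a * j%:R < S m - a * m%:R.
  move=> jn mj jq.
  have jm0 : 0 < j%:R - m%:R :> R by rewrite subr_gt0 ltr_nat.
  have : slope S m j < a.
    rewrite lt_neqAle (q_max (Ordinal (_ : (j < n.+1)%N)))// andbT.
    move: jq; rewrite neq_ltn => /orP[jq|qj]; first exact: gen.
    by rewrite eq_sym; exact: gen.
  by rewrite /slope ltr_pdivrMr//; lra.
have Habove : above S n m q.
  move=> j jn jm jq; move: (jm); rewrite neq_ltn => /orP[jm'|mj]; last exact: strict.
  by apply: Hm => //; rewrite q_gt.
have [iq|qi] := ltnP i q; first by exists m, q; split.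
apply: (IH q) => //; first by move: md q_gt; lia.
move=> r j /andP[qr rn] jq.
have rq0 : 0 < r%:R - (nat_of_ord q)%:R :> R by rewrite subr_gt0 ltr_nat.
have Eq : S q - a * (nat_of_ord q)%:R = S m - a * m%:R by exact: slopeE.
have ba : slope S q r < a.
  rewrite {1}/slope ltr_pdivrMr//.
  have := strict r rn (ltn_trans q_gt qr) (negbT (gtn_eqF qr)); lra.
have Sj : S j - a * j%:R <= S m - a * m%:R.
  have [->//|jm] := eqVneq j m.
  have [->|jq'] := eqVneq j q; first by rewrite Eq.
  by apply: ltW; apply: Habove => //; rewrite (leq_trans (ltnW jq)).
(* Replacing slope [a] by the smaller slope of the chord from [q] to [r] lifts the tilted walk less
   at [j] than at [q], so the weak inequality [Sj] becomes the strict invariant at [q]. *)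
have : (a - slope S q r) * j%:R < (a - slope S q r) * (nat_of_ord q)%:R.
  by rewrite ltr_pM2l ?subr_gt0// ltr_nat.
by lra.
Qed.

(** Steeper edges lie further left. The first support line bounds the walk at [q'], the second at
    [p]; adding the two bounds gives (s' - s) q' <= (s' - s) p for the slopes s < s'. *)
Lemma above_disjoint S n p q p' q' : (p < q)%N -> (q <= n)%N -> (p' < q')%N -> (q' <= n)%N ->
  above S n p q -> above S n p' q' -> slope S p q < slope S p' q' -> (q' <= p)%N.
Proof.
move=> pq qn pq' qn' A A' ss; rewrite leqNgt; apply/negP => pq1.
have E := slopeE S pq; have E' := slopeE S pq'.
have H1 : S q' - slope S p q * q'%:R <= S p - slope S p q * p%:R.
  have [->//|h1] := eqVneq q' p; have [->|h2] := eqVneq q' q; first by rewrite E.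
  by apply: ltW; apply: A.
have H2 : S p - slope S p' q' * p%:R <= S q' - slope S p' q' * q'%:R.
  have [->//|h1] := eqVneq p q'; have [->|h2] := eqVneq p p'; first by rewrite E'.
  by rewrite E'; apply: ltW; apply: A' => //; lia.
have : (slope S p' q' - slope S p q) * p%:R < (slope S p' q' - slope S p q) * q'%:R.
  by rewrite ltr_pM2l ?subr_gt0// ltr_nat.
by lra.
Qed.

(** Edges of different slopes cannot share the step [i] by [above_disjoint]. Edges of equal slope
    have the same support line, and strictness off the endpoints forces the endpoints to agree. *)
Lemma above_unique S n i p q p' q' : (p <= i < q)%N -> (q <= n)%N -> (p' <= i < q')%N -> (q' <= n)%N ->
  above S n p q -> above S n p' q' -> p = p' /\ q = q'.
Proof.
move=> /andP[pi iq] qn /andP[pi' iq'] qn' A A'.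
have pq := leq_ltn_trans pi iq; have pq' := leq_ltn_trans pi' iq'.
have [ss|ss|ss] := ltgtP (slope S p q) (slope S p' q').
- by have := above_disjoint pq qn pq' qn' A A' ss; lia.
- by have := above_disjoint pq' qn' pq qn A' A ss; lia.
have E := slopeE S pq; have E' := slopeE S pq'.
have HA j : (j <= n)%N -> S j - slope S p q * j%:R <= S p - slope S p q * p%:R.
  move=> jn; have [->//|h1] := eqVneq j p; have [->|h2] := eqVneq j q; first by rewrite E.
  by apply: ltW; exact: A.
have HA' j : (j <= n)%N -> S j - slope S p q * j%:R <= S p' - slope S p q * p'%:R.
  rewrite ss => jn.
  have [->//|h1] := eqVneq j p'; have [->|h2] := eqVneq j q'; first by rewrite E'.
  by apply: ltW; exact: A'.
have pn : (p <= n)%N by lia.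
have pn' : (p' <= n)%N by lia.
have EE : S p - slope S p q * p%:R = S p' - slope S p q * p'%:R.
  by apply/eqP; rewrite eq_le HA// HA'.
have pp : p = p'.
  apply/eqP/negP => /negP h.
  have h2 : p' != q by lia.
  by have := A _ pn'; rewrite eq_sym h h2 => /(_ isT isT); rewrite EE ltxx.
split => //; apply/eqP/negP => /negP h.
have h2 : q' != p by lia.
have := A _ qn' h2; rewrite eq_sym h => /(_ isT); rewrite ss E' -ss EE.
by rewrite pp ltxx.
Qed.

End concave_majorant.

Lemma sum_ord_itv n p q : (\sum_(i < n) (p <= i < q) = minn q n - minn p n)%N.
Proof. by elim: n => [|n IH]; rewrite ?big_ord0 ?big_ord_recr/= ?IH; lia. Qed.

(** * Blocks, their deletion and their rotations *)

Section blocks.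
Context {R : realFieldType}.
Implicit Types (x y u v w : seq R) (a c s : R).

(* y forms a single edge of the concave majorant of its own walk. *)
Definition single y := all (fun j => psum y j < avg y * j%:R) (iota 1 (size y).-1).

(** The walk tilted by [a] has its strict maximum at [p]: this is the vertex of the majorant at
    which an edge of slope [a] fits in. *)
Definition peak a x p :=
  all (fun j => (j == p) || (psum x j - a * j%:R < psum x p - a * p%:R))
      (iota 0 (size x).+1).

Definition block x p l :=
  single (take l (drop p x)) &&
  peak (avg (take l (drop p x))) (take p x ++ drop (p + l) x) p.

Lemma peakP a x p : reflect
  (forall j, (j <= size x)%N -> j != p -> psum x j - a * j%:R < psum x p - a * p%:R)
  (peak a x p).
Proof.
apply: (iffP allP) => H j.
  move=> jx jp; have := H j; rewrite mem_iota/= add0n ltnS jx => /(_ isT).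
  by rewrite (negbTE jp).
by rewrite mem_iota/= add0n ltnS => jx; case: eqVneq => //= jp; exact: H.
Qed.

Lemma singleP y : reflect
  (forall j, (0 < j < size y)%N -> psum y j < avg y * j%:R) (single y).
Proof.
apply: (iffP allP) => H j.
  by move=> jy; apply: H; rewrite mem_iota; lia.
by rewrite mem_iota => jy; apply: H; lia.
Qed.

Lemma avg_slope x p l : (0 < l)%N -> (p + l <= size x)%N ->
  avg (take l (drop p x)) = slope (psum x) p (p + l).
Proof.
move=> l0 plx; rewrite /avg /slope size_takel ?size_drop; last by lia.
rewrite natrD [_ - p%:R]addrAC subrr add0r; congr (_ / _).
by rewrite -/(psum (drop p x) l) psum_drop.
Qed.

Lemma psum_remove_l x p l j : (j <= p)%N -> (p + l <= size x)%N ->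
  psum (take p x ++ drop (p + l) x) j = psum x j.
Proof.
by move=> jp plx; rewrite psum_catl ?psum_take// size_takel; lia.
Qed.

Lemma psum_remove_r x p l j : (p + l <= size x)%N ->
  psum (take p x ++ drop (p + l) x) (p + j) =
  psum x p + (psum x (p + l + j) - psum x (p + l)).
Proof.
move=> plx; have sp : size (take p x) = p by rewrite size_takel; lia.
by have := psum_catr (take p x) (drop (p + l) x) j; rewrite sp => ->; rewrite psum_drop.
Qed.

(** Tilted by the slope of the chord, the walk has equal heights at [p] and [p + l]. Deleting the
    piece therefore keeps all tilted heights outside it: these give [peak], the heights inside give
    [single]. *)
Lemma blockP x p l : (0 < l)%N -> (p + l <= size x)%N ->
  reflect (above (psum x) (size x) p (p + l)) (block x p l).
Proof.
move=> l0 plx; rewrite /block avg_slope//; set a := slope _ _ _.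
have sy : size (take l (drop p x)) = l by rewrite size_takel// size_drop; lia.
have Ea : psum x (p + l) - a * (p + l)%:R = psum x p - a * p%:R.
  by apply: slopeE; lia.
have sx' : size (take p x ++ drop (p + l) x) = (size x - l)%N.
  by rewrite size_cat size_takel ?size_drop; lia.
apply: (iffP andP) => [[/singleP H1 /peakP H2] j jx jp jpl|H].
- have [j1|j1] := ltnP j p.
    have := H2 j; rewrite !psum_remove_l//; last exact: ltnW.
    by apply=> //; rewrite sx'; lia.
  have [j2|j2] := ltnP j (p + l).
    have := H1 (j - p)%N; rewrite sy => /(_ ltac:(lia)).
    rewrite avg_slope// -/a psum_take; last by lia.
    by rewrite psum_drop subnKC// natrB//; lra.
  have := H2 (j - l)%N; rewrite sx' => /(_ ltac:(lia) ltac:(lia)).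
  have -> : (j - l = p + (j - (p + l)))%N by lia.
  rewrite psum_remove_r// psum_remove_l// subnKC//.
  by move: Ea; rewrite -/a !natrD natrB// natrD; lra.
- split.
    apply/singleP => j; rewrite sy => jl.
    rewrite avg_slope// -/a psum_take; last by lia.
    rewrite psum_drop; have := H (p + j)%N ltac:(lia) ltac:(lia) ltac:(lia).
    by rewrite -/a natrD; lra.
  apply/peakP => j; rewrite sx' => jx jp.
  have [j1|j1] := ltnP j p.
    rewrite !psum_remove_l//; last exact: ltnW.
    by apply: H; lia.
  have := H (j + l)%N ltac:(lia) ltac:(lia) ltac:(lia).
  have -> : j = (p + (j - p))%N by lia.
  rewrite psum_remove_r// psum_remove_l// -/a.
  have -> : (p + (j - p) + l = p + l + (j - p))%N by lia.
  by move: Ea; rewrite !natrD natrB//; lra.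
Qed.

Definition generic x :=
  forall i j k, (i < j)%N -> (j < k)%N -> (k <= size x)%N ->
    slope (psum x) i j != slope (psum x) i k.

(** Double counting: the weight [l.+1] is the number of indices covered by the block, and each index
    is covered by exactly one block, by [exists_above] and [above_unique]. *)
Lemma sum_block x : generic x ->
  (\sum_(l < size x) \sum_(p < size x - l) l.+1 * block x p l.+1 = size x)%N.
Proof.
set n := size x => gen.
under eq_bigr => l _ do rewrite (big_ord_widen n (fun p => l.+1 * block x p l.+1)%N (leq_subr _ _)).
rewrite (pair_big_dep xpredT (fun l p : 'I_n => p < n - l)%N
  (fun l p : 'I_n => l.+1 * block x p l.+1)%N)/=.
have H (c : 'I_n * 'I_n) : (c.2 < n - c.1)%N -> (c.1.+1 * block x c.2 c.1.+1 =
    \sum_(i < n) (block x c.2 c.1.+1 && (c.2 <= i < c.2 + c.1.+1)))%N.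
  move=> cn; case: block => /=; last by rewrite muln0 big1.
  by rewrite muln1 sum_ord_itv; lia.
rewrite (eq_bigr _ H) exchange_big/= -[RHS]card_ord -sum1_card.
apply: eq_bigr => i _.
have [p [q [pi iq qn A]]] := exists_above gen (ltn_ord i).
have pn : (p < n)%N by lia.
have ln : (q - p.+1 < n)%N by lia.
have qE : (q = p + (q - p.+1).+1)%N by lia.
rewrite (bigD1 (Ordinal ln, Ordinal pn))/=; last by lia.
rewrite (introT (blockP _ _)) -?qE//; last first.
  by move: A; rewrite {1}qE.
rewrite pi iq big1// => -[l' p'] /= /andP[c'n c'_neq].
case: (boolP (block _ _ _)) => // B; case: (boolP (p' <= i < _)%N) => // ip.
have plx : (p' + l'.+1 <= n)%N by lia.
have A' := elimT (blockP _ plx) B.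
have piq : (p <= i < q)%N by rewrite pi.
have [pp qq] := above_unique ip plx piq qn (A' isT) A.
move: c'_neq; rewrite xpair_eqE -!val_eqE/=; lia.
Qed.

Lemma peak_count a x :
  (forall i j, (i < j)%N -> (j <= size x)%N ->
    psum x i - a * i%:R != psum x j - a * j%:R) ->
  (\sum_(p < (size x).+1) peak a x p = 1)%N.
Proof.
set n := size x => gen.
pose f (p : 'I_n.+1) : R := psum x p - a * p%:R.
pose p : 'I_n.+1 := [arg max_(p > ord0) f p]%O.
have p_max j : f j <= f p by rewrite /p; case: arg_maxP => // i _; apply.
have f_inj (i j : 'I_n.+1) : i != j -> f i != f j.
  rewrite neq_ltn => /orP[ij|ji]; first by apply: gen => //; rewrite -ltnS.
  by rewrite eq_sym; apply: gen => //; rewrite -ltnS.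
rewrite (bigD1 p)//= (introT (peakP _ _ _)) => [|j jn jp].
  rewrite big1// => i ip; apply/eqP; rewrite eqb0; apply/negP => /peakP H.
  have := H p; rewrite -ltnS ltn_ord => /(_ isT).
  rewrite eq_sym (inj_eq val_inj) => /(_ ip).
  by rewrite ltNge p_max.
have jn' : (j < n.+1)%N by [].
have := p_max (Ordinal jn'); rewrite le_eqVlt => /orP[|//].
by rewrite (negbTE (f_inj (Ordinal jn') p _)).
Qed.

Lemma psum_rot y r j : (r <= size y)%N -> (j <= size y)%N ->
  psum (rot r y) j = if (r + j <= size y)%N then psum y (r + j) - psum y r
    else (\sum_(z <- y) z) - psum y r + psum y (r + j - size y).
Proof.
move=> ry jy; rewrite /rot; case: ifPn => rj.
  by rewrite psum_catl ?psum_drop// size_drop; lia.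
have -> : (j = size (drop r y) + (r + j - size y))%N by rewrite size_drop; lia.
rewrite psum_catr sum_drop psum_take; last lia.
by congr (_ - _ + psum y _); rewrite size_drop; lia.
Qed.

Lemma sum_rot y r : \sum_(z <- rot r y) z = \sum_(z <- y) z.
Proof. by apply: perm_big; rewrite perm_rot. Qed.

Lemma avg_rot y r : avg (rot r y) = avg y.
Proof. by rewrite /avg sum_rot size_rot. Qed.

Lemma clip_cost_rot y r : clip_cost (rot r y) = clip_cost y.
Proof. by rewrite /clip_cost avg_rot; apply: perm_big; rewrite perm_rot. Qed.

(* Cyclic lemma: a rotation is a single block iff it starts at the peak of the
   bridge psum y j - avg y * j. *)
Lemma single_rot y r : (r < size y)%N ->
  single (rot r y) = peak (avg y) (take (size y).-1 y) r.
Proof.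
move=> ry; have y0 : (0 < size y)%N by lia.
have Ea := avgE y0.
have st : size (take (size y).-1 y) = (size y).-1 by rewrite size_takel; lia.
apply/singleP/peakP; rewrite size_rot ?st avg_rot => H j.
  move=> jy jr; rewrite !psum_take; [|lia|lia].
  have [rj|jr'] := leqP r j.
    have := H (j - r)%N ltac:(lia).
    rewrite psum_rot; [|lia|lia]; rewrite ifT; last lia.
    by rewrite subnKC// natrB//; lra.
  have := H (j + size y - r)%N ltac:(lia).
  rewrite psum_rot; [|lia|lia].
  have -> : (r + (j + size y - r) = size y + j)%N by lia.
  have [j0|j0] := eqVneq j 0%N.
    rewrite j0 addn0 leqnn add0n natrB; last lia.
    by rewrite psum_size -Ea psum0; lra.
  rewrite ifF; last lia.
  by rewrite addKn natrB ?natrD -?Ea; [lra|lia].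
move=> jy; rewrite psum_rot; [|lia|lia]; case: ifPn => rj.
  have [E|rj'] := eqVneq (r + j)%N (size y).
    have := H 0%N ltac:(lia) ltac:(lia); rewrite !psum_take; [|lia|lia].
    rewrite E psum_size psum0 -Ea -E natrD; lra.
  have := H (r + j)%N ltac:(lia) ltac:(lia); rewrite !psum_take; [|lia|lia].
  by rewrite natrD; lra.
have := H (r + j - size y)%N ltac:(lia) ltac:(lia); rewrite !psum_take; [|lia|lia].
by rewrite natrB ?natrD -?Ea; [lra|lia].
Qed.

Lemma sum_single_rot y : (0 < size y)%N ->
  (forall i j, (i < j)%N -> (j < size y)%N ->
    psum y i - avg y * i%:R != psum y j - avg y * j%:R) ->
  (\sum_(r < size y) single (rot r y) = 1)%N.
Proof.
move=> y0 gen.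
have st : size (take (size y).-1 y) = (size y).-1 by rewrite size_takel; lia.
rewrite -(@peak_count (avg y) (take (size y).-1 y)).
  rewrite st prednK//; apply: eq_bigr => r _; rewrite single_rot//.
by move=> i j ij; rewrite st => jy; rewrite !psum_take; [apply: gen|lia|lia]; lia.
Qed.

Lemma near_simplex_block x p l s : (0 < l)%N -> (p + l <= size x)%N -> block x p l ->
  near_simplex x s <->
  near_simplex (take p x ++ drop (p + l) x) (s - clip_cost (take l (drop p x))).
Proof.
move=> l0 plx B; have /blockP A := B; have {}A := A l0 plx.
have sy : size (take l (drop p x)) = l by rewrite size_takel// size_drop; lia.
have xE : x = take p x ++ take l (drop p x) ++ drop (p + l) x.
  by rewrite addnC -drop_drop !cat_take_drop.
have /slopeE : (p < p + l)%N by lia.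
move=> /(_ _ (psum x)); rewrite -avg_slope// => Ea.
rewrite {1}xE; apply: near_simplex_remove; rewrite ?sy//.
- rewrite size_takel; last by lia.
  move=> j jp; rewrite -/(psum x p) psum_take// natrB//.
  have [->|h] := eqVneq j p; first by lra.
  by have := A j ltac:(lia) h ltac:(lia); rewrite -avg_slope//; lra.
- move=> j jl; rewrite psum_take// psum_drop.
  have [->|h] := eqVneq j 0%N; first by rewrite addn0 mulr0; lra.
  have [->|h'] := eqVneq j l; first by move: Ea; rewrite natrD; lra.
  by have := A (p + j)%N ltac:(lia) ltac:(lia) ltac:(lia); rewrite -avg_slope// natrD; lra.
- move=> j; rewrite size_drop psum_drop => jx.
  have [->|h] := eqVneq j 0%N; first by rewrite addn0 mulr0; lra.
  have := A (p + l + j)%N ltac:(lia) ltac:(lia) ltac:(lia); rewrite -avg_slope//.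
  by move: Ea; rewrite !natrD; lra.
Qed.

(** The first [l] entries span a first edge of the majorant, with ties allowed. *)
Definition leading x l := all (fun j => psum x j <= avg (take l x) * j%:R) (iota 0 (size x).+1).

Lemma leadingP x l : reflect
  (forall j, (j <= size x)%N -> psum x j <= avg (take l x) * j%:R) (leading x l).
Proof.
apply: (iffP allP) => H j.
  by move=> jx; apply: H; rewrite mem_iota.
by rewrite mem_iota/= add0n ltnS => jx; apply: H.
Qed.

(** Replaces the existential over points of the simplex by a finite disjunction over shorter
    sequences, which makes measurability provable by induction. Allowing ties makes it valid for
    every nonempty [x], generic or not; the prefix of largest average is always leading. *)
Lemma near_simplex_leading x s : (0 < size x)%N ->
  near_simplex x s <-> exists l : 'I_(size x), leading x l.+1 /\
    near_simplex (drop l.+1 x) (s - clip_cost (take l.+1 x)).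
Proof.
move=> x0.
have E (l : 'I_(size x)) : leading x l.+1 ->
    near_simplex x s <-> near_simplex (drop l.+1 x) (s - clip_cost (take l.+1 x)).
  move=> /leadingP H; have lx := ltn_ord l.
  have sy : size (take l.+1 x) = l.+1 by rewrite size_takel.
  rewrite -{1}(cat_take_drop l.+1 x).
  apply: (@near_simplex_remove _ [::]); rewrite ?sy//.
  - by case=> //= _; rewrite psum0 big_nil mulr0 subr0.
  - by move=> j jl; rewrite psum_take//; apply: H; lia.
  - move=> j; rewrite size_drop psum_drop => jx.
    have := H (l.+1 + j)%N ltac:(lia); have := @avgE _ (take l.+1 x).
    by rewrite sy -/(psum x l.+1) => /(_ isT); rewrite natrD; lra.
split=> [H|[l [L H]]]; last by apply/(E l).
pose f (l : 'I_(size x)) := avg (take l.+1 x).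
pose l : 'I_(size x) := [arg max_(l > Ordinal x0) f l]%O.
have l_max j : f j <= f l by rewrite /l; case: arg_maxP => // i _; apply.
suff L : leading x l.+1 by exists l; split => //; apply/(E l).
apply/leadingP => -[|j] jx; first by rewrite psum0 mulr0.
have := l_max (Ordinal jx); rewrite /f/= {1}/avg size_takel// ler_pdivrMr ?ltr0n//.
Qed.

Lemma near_simplex_nil s : near_simplex [::] s <-> 0 <= s.
Proof.
split=> [[k [/size0nil -> _]]|s0]; first by rewrite /cost big_nil.
by exists [::]; split => //; rewrite /cost big_nil.
Qed.

End blocks.

(** * The size-biased recursion *)

Section measurable_blocks.
Context {R : realType} d (T : measurableType d).
Implicit Types xs ys : T -> seq R.

Lemma measurable_bool_EFin (b : T -> bool) : measurable_fun setT b ->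
  measurable_fun [set: T] (fun t => ((b t)%:R : R)%:E).
Proof.
move=> mb; rewrite (_ : (fun t => _) = (fun t => if b t then 1%E else 0%E)).
  by apply: measurable_fun_ifT => //; exact: measurable_cst.
by apply/funext => t; case: (b t).
Qed.

Lemma measurable_all_in (I : eqType) (r : seq I) (b : I -> T -> bool) :
  (forall i, i \in r -> measurable_fun setT (b i)) ->
  measurable_fun [set: T] (fun t => all (b ^~ t) r).
Proof.
elim: r => [|i r IH] mb; first exact: measurable_cst.
apply: measurable_and; first by apply: mb; rewrite mem_head.
by apply: IH => j jr; apply: mb; rewrite inE jr orbT.
Qed.

Lemma measurable_has_in (I : eqType) (r : seq I) (b : I -> T -> bool) :
  (forall i, i \in r -> measurable_fun setT (b i)) ->
  measurable_fun [set: T] (fun t => has (b ^~ t) r).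
Proof.
elim: r => [|i r IH] mb; first exact: measurable_cst.
apply: measurable_or; first by apply: mb; rewrite mem_head.
by apply: IH => j jr; apply: mb; rewrite inE jr orbT.
Qed.

Lemma measurable_psum n xs j : (j <= n)%N -> mseq n xs ->
  measurable_fun [set: T] (fun t => psum (xs t) j).
Proof. by move=> jn mxs; apply: measurable_sum_seq (mseq_take jn mxs). Qed.

Lemma measurable_avg n xs : mseq n xs -> measurable_fun [set: T] (fun t => avg (xs t)).
Proof.
move=> mxs; rewrite /avg; under eq_fun do rewrite mxs.1.
apply: measurable_funM; last exact: measurable_cst.
exact: measurable_sum_seq mxs.
Qed.

Lemma measurable_clip_cost n xs : mseq n xs ->
  measurable_fun [set: T] (fun t => clip_cost (xs t)).
Proof.
move=> mxs; have ma := measurable_avg mxs.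
apply: (measurable_sum_mseq (f := fun t x => (x - clip (avg (xs t))) ^+ 2) mxs) => i.
apply: measurable_funX; apply: measurable_funB; first exact: mxs.2.
apply: measurable_maxr; first exact: measurable_cst.
by apply: measurable_minr; first exact: measurable_cst.
Qed.

Lemma measurable_single n ys : mseq n ys ->
  measurable_fun [set: T] (fun t => single (ys t)).
Proof.
move=> mys; rewrite /single; under eq_fun do rewrite mys.1.
apply: (@measurable_all_in _ _ (fun j t => psum (ys t) j < avg (ys t) * j%:R)) => j.
rewrite mem_iota => jn; apply: measurable_fun_ltr.
  by apply: measurable_psum mys; lia.
by apply: measurable_funM; [exact: measurable_avg mys|exact: measurable_cst].
Qed.

Lemma measurable_peak n xs (a : T -> R) p : (p <= n)%N -> mseq n xs ->
  measurable_fun setT a -> measurable_fun [set: T] (fun t => peak (a t) (xs t) p).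
Proof.
move=> pn mxs ma; rewrite /peak; under eq_fun do rewrite mxs.1.
apply: (@measurable_all_in _ _ (fun j t => (j == p) ||
  (psum (xs t) j - a t * j%:R < psum (xs t) p - a t * p%:R))) => j.
rewrite mem_iota => jn; apply: measurable_or; first exact: measurable_cst.
apply: measurable_fun_ltr; apply: measurable_funB;
  do ?[by apply: measurable_psum mxs; lia];
  by apply: measurable_funM => //; exact: measurable_cst.
Qed.

Lemma measurable_leading n xs l : (l <= n)%N -> mseq n xs ->
  measurable_fun [set: T] (fun t => leading (xs t) l).
Proof.
move=> ln mxs; rewrite /leading; under eq_fun do rewrite mxs.1.
apply: (@measurable_all_in _ _
  (fun j t => psum (xs t) j <= avg (take l (xs t)) * j%:R)) => j.
rewrite mem_iota => jn; apply: measurable_fun_ler.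
  by apply: measurable_psum mxs; lia.
apply: measurable_funM; last exact: measurable_cst.
exact: measurable_avg (mseq_take ln mxs).
Qed.

Lemma measurable_near n xs (s : T -> R) : mseq n xs -> measurable_fun setT s ->
  measurable_fun [set: T] (fun t => `[< near_simplex (xs t) (s t) >]).
Proof.
elim/ltn_ind: n xs s => -[|n] IH xs s mxs ms.
  rewrite (_ : (fun t => _) = (fun t => 0 <= s t)).
    by apply: measurable_fun_ler => //; exact: measurable_cst.
  apply/funext => t; rewrite (size0nil (mxs.1 t)).
  by apply/asboolP/idP => /near_simplex_nil.
rewrite (_ : (fun t => _) = (fun t => has (fun l => leading (xs t) l.+1 &&
    `[< near_simplex (drop l.+1 (xs t)) (s t - clip_cost (take l.+1 (xs t))) >])
    (iota 0 n.+1))).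
  apply: (@measurable_has_in _ _ (fun l t => leading (xs t) l.+1 &&
    `[< near_simplex (drop l.+1 (xs t)) (s t - clip_cost (take l.+1 (xs t))) >])) => l.
  rewrite mem_iota/= add0n => ln; apply: measurable_and; first exact: measurable_leading mxs.
  apply: (IH (n.+1 - l.+1)%N) => //; first by lia.
    exact: mseq_drop.
  apply: measurable_funB => //.
  exact: measurable_clip_cost (mseq_take ln mxs).
apply/funext => t; have x0 : (0 < size (xs t))%N by rewrite mxs.1.
apply/asboolP/hasP => [/(near_simplex_leading _ x0)[l [L H]]|[l]].
  exists (l : nat); last by rewrite L; exact/asboolP.
  by rewrite mem_iota/= add0n -(mxs.1 t) ltn_ord.
rewrite mem_iota/= add0n -(mxs.1 t) => ln /andP[L /asboolP H].
by apply/(near_simplex_leading _ x0); exists (Ordinal ln).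
Qed.

End measurable_blocks.

(** * Ties form null sets *)

Section generic_sequences.
Context {R : realType}.

Lemma psumE n (x : seq R) j : size x = n -> (j <= n)%N ->
  psum x j = \sum_(t < n) (t < j)%:R * x`_t.
Proof.
move=> xn jn; rewrite /psum (big_nth 0) size_takel ?xn//.
rewrite (eq_big_nat _ _ (F2 := fun t => x`_t)); last first.
  by move=> t /andP[_ tj]; rewrite nth_take.
rewrite big_mkord (big_ord_widen n (fun t => x`_t)) ?xn// big_mkcond/=.
by apply: eq_bigr => t _; case: (t < j)%N; rewrite ?mul1r ?mul0r.
Qed.

Lemma iae_psum n i j k (p q r b : R) : (i <= n)%N -> (j <= n)%N -> (k <= n)%N ->
  (exists2 t, (t < n)%N & p * (t < i)%:R + q * (t < j)%:R + r * (t < k)%:R != 0) ->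
  iae n (fun x => p * psum x i + q * psum x j + r * psum x k != b).
Proof.
move=> i_n j_n k_n H; have := iae_hyperplane b H.
apply: iaeW => x xn; rewrite !(psumE xn)// !mulr_sumr -!big_split/=.
apply: contra => /eqP <-; apply/eqP; apply: eq_bigr => t _.
by rewrite !mulrA -!mulrDl.
Qed.

Lemma iae_generic n : iae n (@generic R).
Proof.
pose P (c : 'I_n.+1 * ('I_n.+1 * 'I_n.+1)) (x : seq R) :=
  (c.1 < c.2.1)%N -> (c.2.1 < c.2.2)%N -> slope (psum x) c.1 c.2.1 != slope (psum x) c.1 c.2.2.
have := @iae_all R n _ (enum (predT : pred ('I_n.+1 * ('I_n.+1 * 'I_n.+1)))) P.
set A := iae n _; move=> H.
have {H} : A.
  apply: H => -[i [j k]] _; rewrite /P/=.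
  have [ij|ij] := ltnP i j; last by apply: iaeT.
  have [jk|jk] := ltnP j k; last by apply: iaeT.
  have ln := ltn_ord k.
  have ji0 : 0 < (j : nat)%:R - (i : nat)%:R :> R by rewrite subr_gt0 ltr_nat.
  have ki0 : 0 < (k : nat)%:R - (i : nat)%:R :> R by rewrite subr_gt0 ltr_nat; lia.
  (* This is the equality of slopes with denominators cleared. The entry of index [j] is counted by
     [psum x k] only, so its coefficient [- (j - i)] is nonzero. *)
  have := @iae_psum n i j k (((j : nat)%:R - (i : nat)%:R) - ((k : nat)%:R - (i : nat)%:R))
    ((k : nat)%:R - (i : nat)%:R) (- ((j : nat)%:R - (i : nat)%:R)) 0.
  move=> /(_ ltac:(lia) ltac:(lia) ltac:(lia)) HH; refine (iaeW _ (HH _)); last first.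
    exists j; first lia.
    rewrite ltnn jk (_ : (j < i)%N = false); last by lia.
    by rewrite !mulr0 !add0r mulr1 oppr_eq0 gt_eqF.
  move=> x _ + _ _; apply: contra.
  rewrite /slope eqr_div ?(gt_eqF ji0) ?(gt_eqF ki0)// => /eqP E.
  by apply/eqP; lra.
apply: iaeW => x xn H i j k ij jk; rewrite xn => kn.
have i1 : (i < n.+1)%N by lia.
have j1 : (j < n.+1)%N by lia.
have k1 : (k < n.+1)%N by lia.
by apply: (H (Ordinal i1, (Ordinal j1, Ordinal k1))) => //; rewrite mem_enum.
Qed.

Lemma iae_pairs n (m : nat) (P : nat -> nat -> seq R -> Prop) :
  (forall i j, (i < j)%N -> (j < m)%N -> iae n (P i j)) ->
  iae n (fun x => forall i j, (i < j)%N -> (j < m)%N -> P i j x).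
Proof.
move=> HP.
have := @iae_all R n _ (enum (predT : pred ('I_m * 'I_m)))
  (fun c x => (c.1 < c.2)%N -> P c.1 c.2 x).
set A := iae n _; move=> H.
have {H} : A.
  apply: H => -[i j] _ /=; have [ij|ij] := ltnP i j; last by apply: iaeT.
  by apply: iaeW (HP i j ij (ltn_ord j)).
apply: iaeW => x xn H i j ij jm.
by apply: (H (Ordinal (ltn_trans ij jm), Ordinal jm)) => //; rewrite mem_enum.
Qed.

Lemma iae_peak n (a : R) : iae n (fun x => forall i j, (i < j)%N -> (j < n.+1)%N ->
  psum x i - a * i%:R != psum x j - a * j%:R).
Proof.
apply: iae_pairs => i j ij jn.
have := @iae_psum n i j 0 1 (-1) 0 (a * i%:R - a * j%:R).
move=> /(_ ltac:(lia) ltac:(lia) ltac:(lia)) HH; refine (iaeW _ (HH _)); last first.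
  exists i; first lia.
  by rewrite ltnn ij mulr0 mul0r add0r addr0 mulr1 oppr_eq0 oner_eq0.
move=> x xn; apply: contra => /eqP E; apply/eqP; lra.
Qed.

Lemma iae_rot n : iae n (fun y : seq R => forall i j, (i < j)%N -> (j < n)%N ->
  psum y i - avg y * i%:R != psum y j - avg y * j%:R).
Proof.
apply: iae_pairs => i j ij jn.
have n0 : n%:R != 0 :> R by rewrite pnatr_eq0; lia.
(* The average is [psum y n / n], so the tie is a linear condition; the entry of index [j] is
   counted by [psum y n] only, with coefficient [(j - i) / n]. *)
have := @iae_psum n i j n 1 (-1) ((j%:R - i%:R) / n%:R) 0.
move=> /(_ ltac:(lia) ltac:(lia) ltac:(lia)) HH; refine (iaeW _ (HH _)); last first.
  exists j => //.
  rewrite ltnn jn (_ : (j < i)%N = false); last by lia.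
  rewrite !mulr0 !add0r mulr1 mulf_neq0 ?invr_eq0//.
  by rewrite subr_eq0 eqr_nat gtn_eqF.
move=> y yn; apply: contra => /eqP.
have -> : psum y n = \sum_(z <- y) z by rewrite -yn psum_size.
rewrite /avg yn; set S := \sum_(_ <- _) _ => E; apply/eqP.
have -> : (j%:R - i%:R) / n%:R * S = S / n%:R * j%:R - S / n%:R * i%:R by ring.
lra.
Qed.

End generic_sequences.

Section size_biased_recursion.
Local Open Scope ereal_scope.
Context {R : realType}.
Implicit Types (x y u v : seq R) (s : R) (n l p : nat).

Definition near_ind (x : seq R) s : \bar R := (`[< near_simplex x s >]%:R : R)%:E.

Definition nearvol n s : \bar R := iint n (fun x => near_ind x s).

Lemma sume_const n (e : \bar R) : \sum_(i < n) e = (n%:R : R)%:E * e.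
Proof.
by rewrite mule_natl; elim: n => [|n IH]; rewrite ?big_ord0// big_ord_recl IH muleS.
Qed.

Lemma EFin_bool_ge0 (b : bool) : 0 <= (b%:R : R)%:E.
Proof. by rewrite lee_fin ler0n. Qed.

Lemma near_ind_ge0 x s : 0 <= near_ind x s. Proof. exact: EFin_bool_ge0. Qed.

Lemma nearvol_ge0 n s : 0 <= nearvol n s.
Proof. by apply: iint_ge0 => x; exact: near_ind_ge0. Qed.

Lemma measurable_near_ind d (T : measurableType d) n (xs : T -> seq R) (s : T -> R) :
  mseq n xs -> measurable_fun setT s ->
  measurable_fun [set: T] (fun t => near_ind (xs t) (s t)).
Proof. by move=> mxs ms; apply: measurable_bool_EFin; exact: measurable_near mxs ms. Qed.

Lemma measurable_nearvol n : measurable_fun [set: R] (nearvol n).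
Proof.
apply: measurable_iint => [s x|d T phi xs mphi mxs]; first exact: near_ind_ge0.
exact: measurable_near_ind mxs mphi.
Qed.

(** A rotation exchanges two groups of variables, so Tonelli suffices. *)
Lemma iint_rot n (g : seq R -> \bar R) r : (r <= n)%N -> (forall y, 0 <= g y) -> seqmeas n g ->
  iint n (fun y => g (rot r y)) = iint n g.
Proof.
move=> rn g0 mg; rewrite -{1}(subnKC rn) iint_cat.
rewrite (@iint_swap R r (n - r) (fun x y => g (rot r (x ++ y)))) => [|//|]; last first.
  move=> d T xs ys mxs mys.
  rewrite (_ : (fun t => _) = fun t => g (ys t ++ xs t)).
    by apply: mg; rewrite -(subnK rn); exact: mseq_cat.
  by apply/funext => t; rewrite -(mxs.1 t) rot_size_cat.
rewrite -{2}(subnK rn) iint_cat; apply: eq_iint => y yn; apply: eq_iint => x xr.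
by rewrite -{1}xr rot_size_cat.
Qed.

Lemma block_cat u y v l p : size u = p -> size y = l ->
  block (u ++ y ++ v) p l = single y && peak (avg y) (u ++ v) p.
Proof.
move=> <- <-; rewrite /block addnC -drop_drop drop_size_cat// take_size_cat//.
by rewrite take_size_cat// drop_size_cat.
Qed.

Lemma near_ind_block u y v s : (0 < size y)%N -> single y ->
  peak (avg y) (u ++ v) (size u) ->
  near_ind (u ++ y ++ v) s = near_ind (u ++ v) (s - clip_cost y).
Proof.
move=> y0 Sy Py; congr (_%:R%:E).
have B : block (u ++ y ++ v) (size u) (size y) by rewrite block_cat// Sy Py.
have sz : (size u + size y <= size (u ++ y ++ v))%N by rewrite !size_cat; lia.
have := near_simplex_block s y0 sz B.
rewrite addnC -drop_drop drop_size_cat// take_size_cat// take_size_cat// drop_size_cat//.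
by move=> H; rewrite (asbool_equiv_eq H).
Qed.

(** The [l] copies are spread over the [l] rotations of [y], which change neither the measure nor
    [H]; almost everywhere exactly one rotation is single. *)
Lemma iint_single_rot l (H : seq R -> \bar R) : (0 < l)%N -> (forall y, 0 <= H y) ->
  seqmeas l H -> (forall y r, H (rot r y) = H y) ->
  (l%:R : R)%:E * iint l (fun y => ((single y)%:R : R)%:E * H y) = iint l H.
Proof.
move=> l0 H0 mH Hrot.
have mS : seqmeas l (fun y => ((single y)%:R : R)%:E).
  by move=> d T ys mys; apply: measurable_bool_EFin; exact: measurable_single mys.
have mSH : seqmeas l (fun y => ((single y)%:R : R)%:E * H y).
  by move=> d T ys mys; apply: emeasurable_funM; [exact: mS|exact: mH].
have SH0 y : 0 <= ((single y)%:R : R)%:E * H y.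
  by rewrite mule_ge0// EFin_bool_ge0.
have mrot r : (r <= l)%N -> seqmeas l (fun y => ((single (rot r y))%:R : R)%:E * H y).
  move=> rl d T ys mys.
  under eq_fun do rewrite -(Hrot _ r).
  apply: mSH; rewrite -(subnK rl); apply: mseq_cat; first exact: mseq_drop.
  exact: (mseq_take rl mys).
transitivity (\sum_(r < l) iint l (fun y => ((single (rot r y))%:R : R)%:E * H y)).
  rewrite (eq_bigr (fun=> iint l (fun y => ((single y)%:R : R)%:E * H y))) => [|r _].
    by rewrite sume_const.
  rewrite -[RHS](iint_rot (ltnW (ltn_ord r)) SH0 mSH).
  by apply: eq_iint => y _; rewrite Hrot.
rewrite -iint_sum; last 2 first.
- by move=> r y; rewrite mule_ge0// EFin_bool_ge0.
- by move=> r; apply: mrot; exact: ltnW.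
apply: eq_iint_ae => //.
- by move=> y; apply: sume_ge0 => r _; rewrite mule_ge0// EFin_bool_ge0.
- by apply: seqmeas_sum => r; apply: mrot; exact: ltnW.
apply: iaeW (iae_rot l) => y yl gen.
rewrite -ge0_sume_distrl; last by move=> r _; exact: EFin_bool_ge0.
rewrite sumEFin -natr_sum.
have := @sum_single_rot R y; rewrite yl => /(_ l0) -> => [|i j ij jl]; last exact: gen.
by rewrite mul1e.
Qed.

(* y is a single block whose slope puts it at position p when inserted into x. *)
Definition inserted (s : R) p (x : seq R) (y : seq R) : \bar R :=
  ((single y)%:R : R)%:E * (((peak (avg y) x p)%:R : R)%:E * near_ind x (s - clip_cost y)).

Lemma inserted_ge0 s p x y : 0 <= inserted s p x y.
Proof. by rewrite /inserted !mule_ge0// EFin_bool_ge0. Qed.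

Lemma measurable_inserted d (T : measurableType d) s p m l (xs ys : T -> seq R) :
  (p <= m)%N -> mseq m xs -> mseq l ys ->
  measurable_fun [set: T] (fun t => inserted s p (xs t) (ys t)).
Proof.
move=> pm mxs mys; apply: emeasurable_funM.
  by apply: measurable_bool_EFin; exact: measurable_single mys.
apply: emeasurable_funM.
  apply: measurable_bool_EFin; apply: measurable_peak pm mxs _.
  exact: measurable_avg mys.
apply: measurable_near_ind mxs _; apply: measurable_funB => //.
exact: measurable_clip_cost mys.
Qed.

(** With x = u ++ y ++ v, the variables of [y] are integrated outermost and [u ++ v] becomes the new
    point. *)
Lemma iint_block n l p s : (0 < l)%N -> (p + l <= n)%N ->
  iint n (fun x => ((block x p l)%:R : R)%:E * near_ind x s) =
  iint l (fun y => iint (n - l) (fun x => inserted s p x y)).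
Proof.
move=> l0 pln; pose q := (n - (p + l))%N.
have -> : n = (p + (l + q))%N by lia.
rewrite iint_cat.
transitivity (iint p (fun u => iint l (fun y => iint q (fun v => inserted s p (u ++ v) y)))).
  apply: eq_iint => u up; rewrite iint_cat; apply: eq_iint => y yl.
  apply: eq_iint => v vq; rewrite block_cat// /inserted.
  case: (boolP (single y)) => Sy; last by rewrite !mul0e.
  case: (boolP (peak _ _ _)) => Py; last by rewrite !mul0e mule0.
  by rewrite !mul1e near_ind_block// ?yl// up.
rewrite (@iint_swap R p l (fun u y => iint q (fun v => inserted s p (u ++ v) y))).
- apply: eq_iint => y yl; have -> : (p + (l + q) - l = p + q)%N by lia.
  by rewrite iint_cat.
- by move=> u y; apply: iint_ge0 => v; exact: inserted_ge0.
- move=> d T us ys mus mys.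
  apply: measurable_iint => [t v|d' T' phi vs mphi mvs]; first exact: inserted_ge0.
  apply: (@measurable_inserted _ _ _ _ (p + q) l).
  + exact: leq_addr.
  + by apply: mseq_cat => //; exact: (mseq_comp mphi mus).
  + exact: (mseq_comp mphi mys).
Qed.

(** Summing over [p] removes the peak condition, since a generic tilted walk has a single peak; the
    factor [l] then removes [single]. *)
Lemma iint_block_sum n l s : (0 < l)%N -> (l <= n)%N ->
  (l%:R : R)%:E *
    \sum_(p < (n - l).+1) iint n (fun x => ((block x p l)%:R : R)%:E * near_ind x s) =
  iint l (fun y => nearvol (n - l) (s - clip_cost y)).
Proof.
move=> l0 ln; set m := (n - l)%N.
have mC d (T : measurableType d) (ys : T -> seq R) : mseq l ys ->
    measurable_fun [set: T] (fun t => (s - clip_cost (ys t))%R).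
  by move=> mys; apply: measurable_funB => //; exact: measurable_clip_cost mys.
rewrite -(@iint_single_rot l (fun y => nearvol m (s - clip_cost y)))//; first last.
- by move=> y r; rewrite clip_cost_rot.
- move=> d T ys mys; apply: (measurableT_comp (measurable_nearvol m)); exact: mC.
- by move=> y; exact: nearvol_ge0.
congr (_ * _).
rewrite (eq_bigr (fun p : 'I_m.+1 => iint l (fun y => iint m (fun x => inserted s p x y)))).
  rewrite -iint_sum; last 2 first.
  - by move=> p y; apply: iint_ge0 => x; exact: inserted_ge0.
  - move=> p d T ys mys.
    apply: measurable_iint => [t x|d' T' phi xs mphi mxs]; first exact: inserted_ge0.
    apply: (@measurable_inserted _ _ _ _ m l) => //; first by rewrite -ltnS.
    exact: (mseq_comp mphi mys).
  apply: eq_iint => y yl.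
  have mI (p : 'I_m.+1) : seqmeas m (fun x => inserted s p x y).
    move=> d T xs mxs; apply: (@measurable_inserted _ _ _ _ m l) => //; first by rewrite -ltnS.
  rewrite -iint_sum//; last by move=> p x; exact: inserted_ge0.
  have mN : seqmeas m (fun x => near_ind x (s - clip_cost y)).
    by move=> d T xs mxs; exact: measurable_near_ind mxs _.
  rewrite -iintZl//; last by move=> x; exact: near_ind_ge0.
  apply: eq_iint_ae.
  - by move=> x; apply: sume_ge0 => p _; exact: inserted_ge0.
  - by move=> x; rewrite mule_ge0// EFin_bool_ge0.
  - exact: seqmeas_sum.
  - exact: seqmeasZl.
  apply: iaeW (iae_peak m (avg y)) => x xm gen.
  rewrite -ge0_sume_distrr; last first.
    by move=> p _; rewrite mule_ge0// EFin_bool_ge0.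
  rewrite -ge0_sume_distrl; last by move=> p _; exact: EFin_bool_ge0.
  rewrite sumEFin -natr_sum.
  have := @peak_count R (avg y) x; rewrite xm => -> => [|i j ij jm]; last exact: gen.
  by rewrite mul1e.
by move=> p _; rewrite iint_block//; have := ltn_ord p; rewrite /m; lia.
Qed.

(* Size-biased recursion: mark each block with weight its length, remove it, and
   use the cyclic lemma to trade that weight for the constraint single y. *)
Lemma nearvol_rec n s : (0 < n)%N ->
  (n%:R : R)%:E * nearvol n s =
  \sum_(l < n) iint l.+1 (fun y => nearvol (n - l.+1) (s - clip_cost y)).
Proof.
move=> n0.
have mN : seqmeas n (fun x => near_ind x s).
  by move=> d T xs mxs; exact: measurable_near_ind mxs _.
have B0 p l x : 0 <= ((block x p l)%:R : R)%:E * near_ind x s.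
  by rewrite mule_ge0// EFin_bool_ge0.
have mB p l : (0 < l)%N -> (p + l <= n)%N ->
    seqmeas n (fun x => ((block x p l)%:R : R)%:E * near_ind x s).
  move=> l0 pln d T xs mxs; apply: emeasurable_funM; last exact: measurable_near_ind mxs _.
  apply: measurable_bool_EFin; apply: measurable_and.
    apply: (@measurable_single _ _ _ l); apply: mseq_take (mseq_drop p mxs); lia.
  apply: (@measurable_peak _ _ _ (p + (n - (p + l)))) => //.
  - exact: leq_addr.
  - by apply: mseq_cat; [apply: mseq_take mxs; lia|exact: mseq_drop].
  - by apply: (@measurable_avg _ _ _ l); apply: mseq_take (mseq_drop p mxs); lia.
transitivity (iint n (fun x => \sum_(l < n) (l.+1%:R : R)%:E *
    \sum_(p < (n - l.+1).+1) (((block x p l.+1)%:R : R)%:E * near_ind x s))).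
  rewrite -iintZl//; last by move=> x; exact: near_ind_ge0.
  apply: eq_iint_ae.
  - by move=> x; rewrite mule_ge0// lee_fin.
  - by move=> x; apply: sume_ge0 => l _; rewrite mule_ge0 ?lee_fin// sume_ge0.
  - exact: seqmeasZl.
  - apply: seqmeas_sum => l; apply: seqmeasZl; apply: seqmeas_sum => p; apply: mB => //.
    by have := ltn_ord l; have := ltn_ord p; lia.
  apply: iaeW (iae_generic n) => x xn gen.
  rewrite (eq_bigr (fun l : 'I_n =>
      (((l.+1 * \sum_(p < (n - l.+1).+1) block x p l.+1)%N)%:R : R)%:E * near_ind x s)).
    rewrite -ge0_sume_distrl; last by move=> l _; rewrite lee_fin.
    rewrite sumEFin -natr_sum; congr (_%:R%:E * _).
    rewrite -{1}xn -(sum_block gen) xn; apply: eq_bigr => l _.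
    by rewrite big_distrr/= subnSK.
  move=> l _; rewrite -ge0_sume_distrl; last by move=> p _; exact: EFin_bool_ge0.
  by rewrite sumEFin -natr_sum muleA -[X in X * _]EFinM -natrM.
rewrite iint_sum; last 2 first.
- by move=> l x; rewrite mule_ge0 ?lee_fin// sume_ge0.
- move=> l; apply: seqmeasZl; apply: seqmeas_sum => p; apply: mB => //.
  by have := ltn_ord l; have := ltn_ord p; lia.
apply: eq_bigr => l _; have ln := ltn_ord l.
rewrite iintZl//; last 2 first.
- by move=> x; rewrite sume_ge0.
- by apply: seqmeas_sum => p; apply: mB => //; have := ltn_ord p; lia.
rewrite -iint_block_sum//; congr (_ * _); rewrite iint_sum// => p.
by apply: mB => //; have := ltn_ord p; lia.
Qed.

End size_biased_recursion.

(** * Integrating out a block *)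

Section helmert.
Local Open Scope ereal_scope.
Context {R : realType}.
Local Notation mu := (@lebesgue_measure R).
Implicit Types (x y z : seq R) (s : R).

Definition sqnorm z : R := (\sum_(a <- z) a ^+ 2)%R.
Definition scatter y : R := (\sum_(a <- y) (a - avg y) ^+ 2)%R.

Lemma sqnorm_cons a z : sqnorm (a :: z) = (a ^+ 2 + sqnorm z)%R.
Proof. by rewrite /sqnorm big_cons. Qed.

Lemma sqnorm_cat y z : sqnorm (y ++ z) = (sqnorm y + sqnorm z)%R.
Proof. by rewrite /sqnorm big_cat. Qed.

Lemma sum_sqr_shift y (c : R) : (0 < size y)%N ->
  (\sum_(a <- y) (a - c) ^+ 2 = sqnorm y - 2 * c * ((size y)%:R * avg y) + (size y)%:R * c ^+ 2)%R.
Proof.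
move=> y0; rewrite [((size y)%:R * _)%R]mulrC avgE// /sqnorm.
elim: y {y0} => [|a y IH] /=; first by rewrite !big_nil; ring.
by rewrite !big_cons IH -natr1; ring.
Qed.

(** Pythagoras: the deviation of [y] from its average is orthogonal to the constant vectors. *)
Lemma clip_cost_scatter y : (0 < size y)%N ->
  clip_cost y = (scatter y + (size y)%:R * (avg y - clip (avg y)) ^+ 2)%R.
Proof. by move=> y0; rewrite /clip_cost /scatter !sum_sqr_shift//; ring. Qed.

Lemma avg_cons a y l : size y = l.+1 ->
  avg (a :: y) = ((a + l.+1%:R * avg y) / l.+2%:R)%R.
Proof. by move=> yl; rewrite {1}/avg big_cons/= yl -yl [(_ * avg _)%R]mulrC avgE// yl. Qed.

Lemma scatter_cons a y l : size y = l.+1 ->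
  scatter (a :: y) = (scatter y + l.+1%:R / l.+2%:R * (a - avg y) ^+ 2)%R.
Proof.
move=> yl; rewrite /scatter !sum_sqr_shift ?yl//= yl (avg_cons _ yl) sqnorm_cons.
have : l.+2%:R != 0%R :> R by rewrite pnatr_eq0.
by rewrite -[l.+2%:R]natr1 => h; field.
Qed.

Lemma measurable_sqnorm d (T : measurableType d) n (zs : T -> seq R) : mseq n zs ->
  measurable_fun [set: T] (fun t => sqnorm (zs t)).
Proof.
move=> mzs; apply: (measurable_sum_mseq (f := fun=> fun a => (a ^+ 2)%R) mzs) => i.
by apply: measurable_funX; exact: mzs.2.
Qed.

Lemma measurable_comp2 d (T : measurableType d) (g : R -> R -> \bar R) (f1 f2 : T -> R) :
  measurable_fun [set: R * R] (fun p => g p.1 p.2) ->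
  measurable_fun setT f1 -> measurable_fun setT f2 ->
  measurable_fun [set: T] (fun t => g (f1 t) (f2 t)).
Proof.
move=> mg m1 m2.
exact: (measurableT_comp mg (measurable_fun_pair m1 m2)).
Qed.

(* Helmert's orthogonal decomposition of R^(l+1) along the diagonal, one coordinate
   at a time; the factor is the length of the diagonal of the unit cube. *)
Lemma helmert l (g : R -> R -> \bar R) : (forall q m, 0 <= g q m) ->
  measurable_fun [set: R * R] (fun p => g p.1 p.2) ->
  iint l.+1 (fun y => g (scatter y) (avg y)) =
  (Num.sqrt l.+1%:R)%:E * \int[mu]_m iint l (fun z => g (sqnorm z) m).
Proof.
elim: l g => [|l IH] g g0 mg.
  rewrite sqrtr1 mul1e; apply: eq_integral => a _ /=.
  have aE : avg [:: a] = a by rewrite /avg big_seq1 divr1.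
  by rewrite /scatter aE /sqnorm big_seq1 subrr expr0n big_nil.
pose c : R := (l.+1%:R / l.+2%:R)%R.
have c0 : (0 < c)%R by rewrite divr_gt0.
pose Phi q m := iint l (fun z => g (sqnorm z + q)%R m).
have Phi0 q m : 0 <= Phi q m by exact: iint_ge0.
have mPhi : measurable_fun [set: R * R] (fun p => Phi p.1 p.2).
  apply: measurable_iint => // d T phi zs mphi mzs.
  apply: (measurable_comp2 mg); last exact: (measurableT_comp measurable_snd).
  apply: measurable_funD; first exact: measurable_sqnorm mzs.
  exact: (measurableT_comp measurable_fst).
have m1 : measurable_fun [set: R * R] (fst : R * R -> R) by exact: measurable_fst.
have m2 : measurable_fun [set: R * R] (snd : R * R -> R) by exact: measurable_snd.
have mcst (r : R) : measurable_fun [set: R * R] (fun=> r) by exact: measurable_cst.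
have mcst1 (r : R) : measurable_fun [set: R] (fun=> r) by exact: measurable_cst.
have mid : measurable_fun [set: R] (fun r : R => r) by exact: measurable_id.
transitivity (\int[mu]_a ((Num.sqrt l.+1%:R)%:E *
    \int[mu]_m Phi (c * (a - m) ^+ 2)%R ((a + l.+1%:R * m) / l.+2%:R)%R)).
  rewrite iintS; apply: eq_integral => a _.
  pose ga q m := g (q + c * (a - m) ^+ 2)%R ((a + l.+1%:R * m) / l.+2%:R)%R.
  rewrite -(IH ga) => [|q m|]; first last.
  - apply: (measurable_comp2 mg).
      apply: measurable_funD => //; apply: measurable_funM => //.
      by apply: measurable_funX; exact: measurable_funB.
    by apply: measurable_funM => //; apply: measurable_funD => //; exact: measurable_funM.
  - exact: g0.
  by apply: eq_iint => y yl; rewrite (scatter_cons _ yl) (avg_cons _ yl).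
rewrite ge0_integralZl_EFin; first last.
- exact: sqrtr_ge0.
- apply: (@measurable_fun_fubini_tonelli_F _ _ R (measurableTypeR R) R mu
    (fun p => Phi (c * (p.1 - p.2) ^+ 2)%R ((p.1 + l.+1%:R * p.2) / l.+2%:R)%R)) => [|p]; last exact: Phi0.
  apply: (measurable_comp2 mPhi).
    by apply: measurable_funM => //; apply: measurable_funX; exact: measurable_funB.
  by apply: measurable_funM => //; apply: measurable_funD => //; exact: measurable_funM.
- by move=> a _; exact: integral_ge0.
- exact: measurableT.
(* Only translations are needed: shifting [a] by [m] turns the new average into [m + w / l.+2], and
   shifting [m] then removes [w / l.+2]. *)
have -> : \int[mu]_a \int[mu]_m Phi (c * (a - m) ^+ 2)%R ((a + l.+1%:R * m) / l.+2%:R)%R =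
    \int[mu]_m \int[mu]_w Phi (c * w ^+ 2)%R m.
  rewrite ge0_integral_swap; [|clear IH|by move=> ? ?; exact: Phi0]; last first.
    apply: (measurable_comp2 mPhi).
      by apply: measurable_funM => //; apply: measurable_funX; exact: measurable_funB.
    by apply: measurable_funM => //; apply: measurable_funD => //; exact: measurable_funM.
  transitivity (\int[mu]_m \int[mu]_w Phi (c * w ^+ 2)%R (m + w / l.+2%:R)%R).
    apply: eq_integral => m _.
    rewrite -(@ge0_integral_shift R m)//; last first.
      apply: (measurable_comp2 mPhi).
        by apply: measurable_funM => //; apply: measurable_funX; exact: measurable_funB.
      by apply: measurable_funM => //; exact: measurable_funD.
    apply: eq_integral => w _; rewrite addrK; congr (Phi _ _).
    have : l.+2%:R != 0%R :> R by rewrite pnatr_eq0.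
    by rewrite -[l.+2%:R]natr1 => h; field.
  have mw : measurable_fun [set: R * R] (fun p => (c * p.2 ^+ 2)%R : R).
    by apply: measurable_funM => //; exact: measurable_funX.
  rewrite ge0_integral_swap; [|clear IH|by move=> ? ?; exact: Phi0]; last first.
    apply: (measurable_comp2 mPhi) => //.
    by apply: measurable_funD => //; exact: measurable_funM.
  rewrite [RHS]ge0_integral_swap; [|exact: (measurable_comp2 mPhi)|by move=> ? ?; exact: Phi0].
  apply: eq_integral => w _; rewrite (@ge0_integral_shift R _ (Phi (c * w ^+ 2)%R))//.
  by apply: (measurable_comp2 mPhi).
(* Scaling [w] by the root of [c] makes [c * w ^+ 2] a pure square, which becomes one more
   coordinate of [z]. The roots of l + 1 and of 1 / c multiply to the root of l + 2. *)
have -> : \int[mu]_m \int[mu]_w Phi (c * w ^+ 2)%R m =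
    ((Num.sqrt c)^-1)%:E * \int[mu]_m iint l.+1 (fun z => g (sqnorm z) m).
  rewrite -ge0_integralZl_EFin//; first last.
  - apply: measurable_iint => // d T phi zs mphi mzs.
    by apply: (measurable_comp2 mg) => //; exact: measurable_sqnorm mzs.
  - by move=> m _; exact: iint_ge0.
  apply: eq_integral => m _.
  have := @ge0_integral_scale R (Num.sqrt c) (fun w => Phi (w ^+ 2)%R m).
  rewrite sqrtr_gt0 => /(_ c0 _ (fun=> Phi0 _ _)) H.
  transitivity (\int[mu]_w Phi ((Num.sqrt c * w) ^+ 2)%R m).
    by apply: eq_integral => w _; rewrite exprMn sqr_sqrtr// ltW.
  rewrite H; last by apply: (measurable_comp2 mPhi) => //; exact: measurable_funX.
  congr (_ * _); apply: eq_integral => w _; apply: eq_iint => z _.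
  by rewrite sqnorm_cons addrC.
rewrite muleA -EFinM; congr (_%:E * _).
by rewrite /c sqrtrM// sqrtrV// invfM invrK mulrA mulfV ?mul1r.
Qed.

End helmert.

Section slab.
Local Open Scope ereal_scope.
Context {R : realType}.
Local Notation mu := (@lebesgue_measure R).
Implicit Types (x y z : seq R) (s : R).

(** The argument [m - clip m] is [m] below 0, zero on [0, 1) and [m - 1] from 1 on, so the unit
    interval yields [h 0] and the outer half-lines join to the whole line. *)
Lemma integral_clip (h : R -> \bar R) : measurable_fun setT h -> (forall m, 0 <= h m) ->
  \int[mu]_m h (m - clip m)%R = h 0%R + \int[mu]_m h m.
Proof.
move=> mh h0.
pose f1 (m : R) := if (m < 0)%R then h m else 0.
pose f2 (m : R) := if (0 <= m < 1)%R then h 0%R else 0.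
pose f3 (m : R) := if (0 <= m)%R then h m else 0.
have mid : measurable_fun [set: R] (fun m : R => m) by exact: measurable_id.
have mc (r : R) : measurable_fun [set: R] (fun=> r) by exact: measurable_cst.
have mce (r : \bar R) : measurable_fun [set: R] (fun=> r) by exact: measurable_cst.
have mf1 : measurable_fun [set: R] f1.
  by apply: measurable_fun_ifT => //; exact: measurable_fun_ltr.
have mf2 : measurable_fun [set: R] f2.
  apply: measurable_fun_ifT => //; apply: measurable_and.
    exact: measurable_fun_ler.
  exact: measurable_fun_ltr.
have mf3 : measurable_fun [set: R] f3.
  by apply: measurable_fun_ifT => //; exact: measurable_fun_ler.
have f10 m : 0 <= f1 m by rewrite /f1; case: ifP.
have f20 m : 0 <= f2 m by rewrite /f2; case: ifP.
have f30 m : 0 <= f3 m by rewrite /f3; case: ifP.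
have mf3' : measurable_fun [set: R] (fun m => f3 (m + -1)%R).
  by apply: (measurableT_comp mf3); apply: measurable_funD.
have f2E : \int[mu]_m f2 m = h 0%R.
  transitivity (\int[mu]_(m in `[0%R, 1%R[) h 0%R).
    rewrite [RHS]integral_mkcond; apply: eq_integral => m _.
    by rewrite patchE mem_setE in_itv.
  by rewrite integral_cst//= lebesgue_measure_itv/= lte_fin ltr01 sube0 mule1.
transitivity (\int[mu]_m (f1 m + (f2 m + f3 (m + -1)%R))).
  apply: eq_integral => m _; rewrite /f1 /f2 /f3 /clip.
  have [m1|m1] := leP 1%R m; last have [m0|m0] := leP 0%R m.
  - have -> : (m < 0)%R = false by lra.
    have -> : (0 <= m - 1)%R by lra.
    by rewrite (max_idPr ler01) andbF !add0e.
  - have -> : (0 <= m - 1)%R = false by lra.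
    by rewrite subrr add0e adde0.
  - have -> : (0 <= m - 1)%R = false by lra.
    by rewrite subr0 !adde0.
rewrite ge0_integralD//; last 2 first.
- by move=> m _; rewrite adde_ge0.
- exact: emeasurable_funD.
rewrite ge0_integralD// f2E ge0_integral_shift// addeCA -ge0_integralD//.
congr (_ + _); apply: eq_integral => m _; rewrite /f1 /f3.
by case: ltP => _; rewrite ?add0e ?adde0.
Qed.

Lemma integral_slab (L s : R) (H : R -> \bar R) : (0 < L)%R ->
  measurable_fun setT H -> (forall q, 0 <= H q) ->
  \int[mu]_m H (s - L * (m - clip m) ^+ 2)%R =
  H s + (Num.sqrt L)^-1%:E * \int[mu]_w H (s - w ^+ 2)%R.
Proof.
move=> L0 mH H0.
have mid : measurable_fun [set: R] (fun m : R => m) by exact: measurable_id.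
have mG (c : R) : measurable_fun [set: R] (fun w : R => H (s - c * w ^+ 2)%R).
  apply: (measurableT_comp mH); apply: measurable_funB => //.
  by apply: measurable_funM => //; exact: measurable_funX.
rewrite (integral_clip (h := fun d => H (s - L * d ^+ 2)%R))// expr0n mulr0 subr0.
congr (_ + _); rewrite -(@ge0_integral_scale R _ (fun w => H (s - w ^+ 2)%R)) ?sqrtr_gt0//.
  by apply: eq_integral => w _; rewrite exprMn sqr_sqrtr// ltW.
by have := mG 1%R; under eq_fun do rewrite mul1r.
Qed.

Definition ballconv k (H : R -> \bar R) s : \bar R := iint k (fun z => H (s - sqnorm z)%R).

Lemma seqmeas_ballconv k (H : R -> \bar R) s : measurable_fun setT H ->
  seqmeas k (fun z => H (s - sqnorm z)%R).
Proof.
move=> mH d T zs mzs; apply: (measurableT_comp mH); apply: measurable_funB => //.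
exact: measurable_sqnorm mzs.
Qed.

Lemma ballconv_add k l (H : R -> \bar R) s :
  ballconv (k + l) H s = ballconv k (ballconv l H) s.
Proof.
rewrite /ballconv iint_cat; apply: eq_iint => y _; apply: eq_iint => z _.
by rewrite sqnorm_cat opprD addrA.
Qed.

(** In the outer part the diagonal factor cancels against the rescaling in [integral_slab], and [w]
    becomes the missing coordinate of [ballconv l.+1]. *)
Lemma iint_clip_cost l (H : R -> \bar R) s : measurable_fun setT H ->
  (forall q, 0 <= H q) ->
  iint l.+1 (fun y => H (s - clip_cost y)%R) =
  (Num.sqrt l.+1%:R)%:E * ballconv l H s + ballconv l.+1 H s.
Proof.
move=> mH H0; pose L : R := l.+1%:R.
have L0 : (0 < L)%R by rewrite /L.
pose g q m := H (s - (q + L * (m - clip m) ^+ 2))%R.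
have mclip d (T : measurableType d) (f : T -> R) : measurable_fun setT f ->
    measurable_fun [set: T] (fun t => clip (f t)).
  move=> mf; apply: measurable_maxr; first exact: measurable_cst.
  by apply: measurable_minr; first exact: measurable_cst.
have mg d (T : measurableType d) (f1 f2 : T -> R) : measurable_fun setT f1 ->
    measurable_fun setT f2 -> measurable_fun [set: T] (fun t => g (f1 t) (f2 t)).
  move=> m1 m2; apply: (measurableT_comp mH); apply: measurable_funB => //.
  apply: measurable_funD => //; apply: measurable_funM => //.
  by apply: measurable_funX; apply: measurable_funB => //; exact: mclip.
transitivity (iint l.+1 (fun y => g (scatter y) (avg y))).
  by apply: eq_iint => y yl; rewrite /g clip_cost_scatter yl.
rewrite helmert; last 2 first.
- by move=> q m; exact: H0.
- by apply: mg; [exact: measurable_fst|exact: measurable_snd].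
rewrite integral_iint; last 2 first.
- by move=> m z; exact: H0.
- move=> d T phi zs mphi mzs; apply: mg => //.
  exact: measurable_sqnorm mzs.
have mB : seqmeas l (fun z => \int[mu]_w H (s - sqnorm z - w ^+ 2)%R).
  apply: (@jmeas_integral R l (fun w z => H (s - sqnorm z - w ^+ 2)%R)) => //.
  move=> d T phi zs mphi mzs; apply: (measurableT_comp mH); apply: measurable_funB.
    by apply: measurable_funB => //; exact: measurable_sqnorm mzs.
  exact: measurable_funX.
transitivity ((Num.sqrt L)%:E * iint l (fun z => H (s - sqnorm z)%R +
    ((Num.sqrt L)^-1)%:E * \int[mu]_w H (s - sqnorm z - w ^+ 2)%R)).
  congr (_ * _); apply: eq_iint => z _; rewrite -integral_slab//.
  by apply: eq_integral => m _; rewrite /g opprD addrA.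
have I0 z : 0 <= \int[mu]_w H (s - sqnorm z - w ^+ 2)%R by exact: integral_ge0.
have sL : (0 <= (Num.sqrt L)^-1)%R by rewrite invr_ge0 sqrtr_ge0.
rewrite iintD//; last 3 first.
- by move=> z; rewrite mule_ge0// lee_fin.
- exact: seqmeas_ballconv.
- exact: seqmeasZl.
rewrite iintZl// ge0_muleDr; last 2 first.
- exact: iint_ge0.
- by rewrite mule_ge0 ?lee_fin//; exact: iint_ge0.
rewrite muleA -EFinM mulfV ?gt_eqF ?sqrtr_gt0// mul1e; congr (_ + _).
rewrite -integral_iint; last 2 first.
- by move=> w z; exact: H0.
- move=> d T phi zs mphi mzs; apply: (measurableT_comp mH); apply: measurable_funB.
    by apply: measurable_funB => //; exact: measurable_sqnorm mzs.
  exact: measurable_funX.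
rewrite /ballconv iintS; apply: eq_integral => w _; apply: eq_iint => z _.
by rewrite sqnorm_cons opprD addrA addrAC.
Qed.

End slab.

(** * Solving the recursion *)

Section coefficients.
Context {R : rcfType}.
Implicit Types (f g h : nat -> R) (k n : nat).

(** A convolution over positive lengths: the index [l] of [f] stands for the length [l.+1]. *)
Definition conv f h n : R := \sum_(l < n) f l * h (n - l.+1)%N.

Lemma convCA f g h n : conv f (conv g h) n = conv g (conv f h) n.
Proof.
have E f1 g1 : conv f1 (conv g1 h) n =
    \sum_(l < n) \sum_(j < n | (l + j.+1 < n)%N) f1 l * g1 j * h (n - (l + j).+2)%N.
  apply: eq_bigr => l _; rewrite /conv mulr_sumr.
  rewrite (big_ord_widen n (fun j => f1 l * (g1 j * h (n - l.+1 - j.+1)%N)) (leq_subr _ _)).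
  apply: eq_big => j; first lia.
  by move=> _; rewrite mulrA -subnDA addSn addnS.
rewrite !E (exchange_big_dep xpredT)//=; apply: eq_bigr => j _.
apply: eq_big => l; first lia.
by move=> _; rewrite [f l * _]mulrC addnC.
Qed.

Lemma conv_add f h h' n : conv f (fun m => h m + h' m) n = conv f h n + conv f h' n.
Proof. by rewrite /conv -big_split/=; apply: eq_bigr => l _; rewrite mulrDr. Qed.

Lemma conv_scale f h (c : R) n : conv f (fun m => c * h m) n = c * conv f h n.
Proof. by rewrite /conv mulr_sumr; apply: eq_bigr => l _; rewrite mulrCA. Qed.

Lemma eq_conv f h h' n : (forall m, h m = h' m) -> conv f h n = conv f h' n.
Proof. by move=> hh'; apply: eq_bigr => l _; rewrite hh'. Qed.

Definition root_succ l : R := Num.sqrt l.+1%:R.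

(* The sum over (l_1, ..., l_k) in A of the product of the 1 / sqrt l_i, peeling off l_1. *)
Fixpoint chain_sum k n : R :=
  if k is k'.+1 then conv (fun l => (root_succ l)^-1) (chain_sum k') n else 1.

Lemma chain_sum_gt k n : (n < k)%N -> chain_sum k n = 0.
Proof.
elim: k n => [|k IH] n //= nk; rewrite /conv big1// => l _.
by rewrite IH ?mulr0//; have := ltn_ord l; lia.
Qed.

(** Write n = l_1 + (n - l_1). The part l_1 turns 1 / sqrt l_1 into sqrt l_1; the rest is the
    induction hypothesis, with [convCA] bringing the root factor to the front. At k = 0 the value of
    [k.-1] is harmless, its factor being 0. *)
Lemma chain_sum_rec k n : n%:R * chain_sum k n =
  k%:R * conv root_succ (chain_sum k.-1) n + conv (fun=> 1) (chain_sum k) n.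
Proof.
elim: k n => [|k IH] n.
  rewrite mul0r add0r /conv /= mulr1; under eq_bigr do rewrite mulr1.
  by rewrite sumr_const card_ord.
have -> : n%:R * chain_sum k.+1 n = conv root_succ (chain_sum k) n +
    conv (fun l => (root_succ l)^-1) (fun m => m%:R * chain_sum k m) n.
  rewrite /= {1}/conv mulr_sumr -big_split/=; apply: eq_bigr => l _.
  have {1}-> : n = (l.+1 + (n - l.+1))%N by rewrite subnKC.
  rewrite natrD mulrDl; congr (_ + _); last by rewrite mulrCA.
  rewrite mulrA; congr (_ * _).
  have r0 : root_succ l != 0 by rewrite gt_eqF// sqrtr_gt0.
  by rewrite -[l.+1%:R]sqr_sqrtr// -/(root_succ l) expr2 mulfK.
rewrite (eq_conv _ _ IH) conv_add convCA conv_scale.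
have -> : k%:R * conv (fun l => (root_succ l)^-1) (conv root_succ (chain_sum k.-1)) n =
    k%:R * conv root_succ (chain_sum k) n.
  by case: k {IH} => [|k]; rewrite ?mul0r// convCA.
by rewrite addrA -natr1 mulrDl mul1r /= [X in X + _]addrC.
Qed.

Definition steiner_coef n k : R := (k`!%:R)^-1 * chain_sum k n.

Lemma steiner_coef_gt n k : (n < k)%N -> steiner_coef n k = 0.
Proof. by move=> nk; rewrite /steiner_coef chain_sum_gt ?mulr0. Qed.

(** The factorial cancels the factor [k.+1] that [chain_sum_rec] puts before the root term. *)
Lemma steiner_coefS n k : n%:R * steiner_coef n k.+1 =
  conv root_succ (steiner_coef ^~ k) n + conv (fun=> 1) (steiner_coef ^~ k.+1) n.
Proof.
rewrite /steiner_coef mulrCA chain_sum_rec mulrDr !conv_scale; congr (_ + _).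
by rewrite mulrA; congr (_ * _); rewrite factS natrM invfM mulrAC mulVf ?mul1r.
Qed.

Lemma steiner_coef0 n : n%:R * steiner_coef n 0 = conv (fun=> 1) (steiner_coef ^~ 0%N) n.
Proof. by rewrite /steiner_coef mulrCA chain_sum_rec mul0r add0r conv_scale. Qed.

End coefficients.

Section nearvol_expansion.
Local Open Scope ereal_scope.
Context {R : realType}.
Implicit Types (s : R).

(** The volume of the ball of squared radius [s] in R^k, since [nearvol 0] is the indicator of the
    nonnegative half-line. *)
Definition ballvol k s : \bar R := ballconv k (nearvol 0) s.

Lemma measurable_ballconv k (H : R -> \bar R) : measurable_fun setT H ->
  (forall q, 0 <= H q) -> measurable_fun [set: R] (ballconv k H).
Proof.
move=> mH H0; apply: measurable_iint => [s z|d T phi zs mphi mzs]; first exact: H0.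
apply: (measurableT_comp mH); apply: measurable_funB => //.
exact: measurable_sqnorm mzs.
Qed.

Lemma ballvol_ge0 k s : 0 <= ballvol k s.
Proof. by apply: iint_ge0 => z; exact: nearvol_ge0. Qed.

Lemma measurable_ballvol k : measurable_fun [set: R] (ballvol k).
Proof. by apply: measurable_ballconv; [exact: measurable_nearvol|exact: nearvol_ge0]. Qed.

Lemma steiner_coef_ge0 n k : (0 <= steiner_coef n k :> R)%R.
Proof.
rewrite /steiner_coef mulr_ge0 ?invr_ge0//.
elim: k n => [|k IH] n //=; apply: sumr_ge0 => l _.
by rewrite mulr_ge0 ?IH// invr_ge0 sqrtr_ge0.
Qed.

Lemma ballconv_expand l m s (c : nat -> R) : (forall k, 0 <= c k)%R ->
  ballconv l (fun q => \sum_(k < m.+1) (c k)%:E * ballvol (m - k) q) s =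
  \sum_(k < m.+1) (c k)%:E * ballvol (l + m - k) s.
Proof.
move=> c0; rewrite /ballconv iint_sum; last 2 first.
- by move=> k z; rewrite mule_ge0 ?lee_fin// ballvol_ge0.
- by move=> k; apply: seqmeasZl; apply: seqmeas_ballconv; exact: measurable_ballvol.
apply: eq_bigr => k _; rewrite iintZl//.
- congr (_ * _); rewrite -addnBA; last by rewrite -ltnS.
  by rewrite /ballvol ballconv_add.
- by move=> z; exact: ballvol_ge0.
- by apply: seqmeas_ballconv; exact: measurable_ballvol.
Qed.

(** Both sides obey the same recursion. Finiteness of the ball volumes moves the comparison of
    coefficients into the reals. *)
Lemma nearvol_expansion n s : (forall k q, ballvol k q \is a fin_num) ->
  nearvol n s = \sum_(k < n.+1) (steiner_coef n k)%:E * ballvol (n - k) s.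
Proof.
move=> fin; elim/ltn_ind: n s => -[|n] IH s.
  rewrite big_ord_recl big_ord0 adde0 /steiner_coef/= fact0 invr1 mulr1 mul1e.
  by rewrite /ballvol /ballconv/= /sqnorm big_nil subr0.
have N0 : n.+1%:R != 0%R :> R by rewrite pnatr_eq0.
suff : (n.+1%:R : R)%:E * nearvol n.+1 s = (n.+1%:R : R)%:E *
    \sum_(k < n.+2) (steiner_coef n.+1 k)%:E * ballvol (n.+1 - k) s.
  move/(congr1 (fun e => ((n.+1%:R)^-1)%:E * e)).
  by rewrite !muleA -!EFinM mulVf// !mul1e.
rewrite nearvol_rec//.
pose b j := fine (ballvol j s).
have bE j : ballvol j s = (b j)%:E by rewrite fineK.
have coefE m : (\sum_(k < m.+1) (steiner_coef m k)%:E * ballvol (m - k) s) =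
    (\sum_(k < m.+1) steiner_coef m k * b (m - k)%N)%:E.
  by rewrite -sumEFin; apply: eq_bigr => k _; rewrite bE.
rewrite coefE -EFinM.
(* Padding with vanishing coefficients gives all [l] the same index range. The root term has one
   variable less, hence balls of dimension [n - k] instead of [n.+1 - k]. *)
have termE (l : 'I_n.+1) : iint l.+1 (fun y => nearvol (n.+1 - l.+1) (s - clip_cost y)) =
    (\sum_(k < n.+1) root_succ l * steiner_coef (n.+1 - l.+1) k * b (n - k)%N +
     \sum_(k < n.+2) 1 * steiner_coef (n.+1 - l.+1) k * b (n.+1 - k)%N)%:E.
  have ln : (l <= n)%N by rewrite -ltnS.
  rewrite iint_clip_cost; last 2 first.
  - exact: measurable_nearvol.
  - exact: nearvol_ge0.
  rewrite subSS; have -> : nearvol (n - l) = fun q => \sum_(k < (n - l).+1)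
      (steiner_coef (n - l) k)%:E * ballvol (n - l - k) q.
    by apply/funext => q; apply: IH; rewrite ltnS leq_subr.
  rewrite !ballconv_expand; do ?[by move=> k; exact: steiner_coef_ge0].
  rewrite addSn subnKC// EFinD; congr (_ + _).
    rewrite (big_ord_widen n.+1 (fun k => (steiner_coef (n - l) k)%:E * ballvol (n - k) s)); last by rewrite ltnS leq_subr.
    rewrite ge0_sume_distrr; last by move=> k _; rewrite mule_ge0 ?lee_fin ?steiner_coef_ge0// ballvol_ge0.
    rewrite big_mkcond/= -sumEFin; apply: eq_bigr => k _.
    case: ifPn => kn; first by rewrite bE muleA.
    by rewrite steiner_coef_gt ?mulr0 ?mul0r//; lia.
  rewrite (big_ord_widen n.+2 (fun k => (steiner_coef (n - l) k)%:E * ballvol (n.+1 - k) s)); last by rewrite ltnS leqW// leq_subr.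
  rewrite big_mkcond/= -sumEFin; apply: eq_bigr => k _.
  case: ifPn => kn; first by rewrite bE mul1r.
  by rewrite steiner_coef_gt ?mulr0 ?mul0r//; lia.
rewrite (eq_bigr _ (fun l _ => termE l)) sumEFin; congr EFin.
rewrite big_split/= exchange_big/= [X in (_ + X)%R]exchange_big/=.
(* Because of that lost dimension the root sum feeds the coefficient of index [k.+1]; the one of
   index 0 receives no root term. *)
rewrite mulr_sumr [RHS]big_ord_recl [X in (_ + X)%R]big_ord_recl/= addrCA; congr (_ + _)%R.
  by rewrite mulrA steiner_coef0 /conv mulr_suml.
rewrite -big_split/=; apply: eq_bigr => k _.
by rewrite mulrA /bump/= add1n steiner_coefS mulrDl /conv !mulr_suml subSS.
Qed.

End nearvol_expansion.

(** * Volume of the unit ball *)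

Section ball_volume.
Local Open Scope ereal_scope.
Context {R : realType}.
Local Notation mu := (@lebesgue_measure R).
Implicit Types (s r : R) (z : seq R).

Lemma sqnorm_ge0 z : (0 <= sqnorm z)%R.
Proof. by apply: sumr_ge0 => a _; exact: sqr_ge0. Qed.

Lemma ballvolE k s : ballvol k s = iint k (fun z => ((sqnorm z <= s)%R%:R : R)%:E).
Proof.
apply: eq_iint => z _; rewrite /nearvol/= /near_ind; congr (_%:R%:E).
by rewrite -[(sqnorm z <= s)%R]subr_ge0; congr nat_of_bool; apply/asboolP/idP => /near_simplex_nil.
Qed.

Lemma measurable_ball_ind d (T : measurableType d) k (zs : T -> seq R) (f : T -> R) :
  mseq k zs -> measurable_fun setT f ->
  measurable_fun [set: T] (fun t => ((sqnorm (zs t) <= f t)%R%:R : R)%:E).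
Proof.
move=> mzs mf; apply: measurable_bool_EFin; apply: measurable_fun_ler => //.
exact: measurable_sqnorm mzs.
Qed.

Lemma iint_scale n (c : R) (g : seq R -> \bar R) : (0 < c)%R -> (forall z, 0 <= g z) ->
  seqmeas n g -> iint n (fun z => g (map ( *%R c) z)) = (c^-1 ^+ n)%:E * iint n g.
Proof.
move=> c0; elim: n g => [|n IH] g g0 mg /=; first by rewrite expr0 mul1e.
have ci : (0 <= c^-1 ^+ n)%R by rewrite exprn_ge0// invr_ge0 ltW.
transitivity (\int[mu]_a ((c^-1 ^+ n)%:E * iint n (fun z => g ((c * a)%R :: z)))).
  apply: eq_integral => a _; rewrite -(IH (fun z => g ((c * a)%R :: z)))//.
  exact: jmeas_seqmeas (seqmeas_cons mg).
have mG := measurable_iint_cons g0 mg.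
rewrite ge0_integralZl_EFin//; last 2 first.
- by move=> a _; exact: iint_ge0.
- apply: (measurableT_comp mG); apply: measurable_funM => //.
rewrite (@ge0_integral_scale R c (fun a => iint n (fun z => g (a :: z))))//; last first.
  by move=> a; exact: iint_ge0.
by rewrite muleA -EFinM exprSr.
Qed.

Lemma ballvol_scale k r : (0 < r)%R -> ballvol k (r ^+ 2) = (r ^+ k)%:E * ballvol k 1.
Proof.
move=> r0; have ri0 : (0 < r^-1)%R by rewrite invr_gt0.
rewrite !ballvolE -[r in (r ^+ k)%R]invrK.
rewrite -(@iint_scale k r^-1 (fun z => ((sqnorm z <= 1)%R%:R : R)%:E))//; last first.
  by move=> d T zs mzs; exact: measurable_ball_ind mzs _.
apply: eq_iint => z _; congr (_%:R%:E).
have -> : sqnorm (map ( *%R r^-1) z) = (sqnorm z / r ^+ 2)%R.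
  rewrite /sqnorm big_map mulr_suml; apply: eq_bigr => a _.
  by rewrite exprMn exprVn mulrC.
by rewrite ler_pdivrMr ?mul1r// exprn_gt0.
Qed.

Lemma iint0 n : iint n (fun=> 0 : \bar R) = 0.
Proof.
by elim: n => [//|n IH]; rewrite iintS; under eq_integral do rewrite IH; rewrite integral0.
Qed.

Lemma ballvol_lt0 k s : (s < 0)%R -> ballvol k s = 0.
Proof.
move=> s0; rewrite ballvolE -(iint0 k); apply: eq_iint => z _.
by rewrite lt_geF// (lt_le_trans s0)// sqnorm_ge0.
Qed.

Lemma ballvol_at0 k : ballvol k 0 = ((0 : R) ^+ k)%:E.
Proof.
rewrite ballvolE; case: k => [|k]; first by rewrite /= /sqnorm big_nil lexx.
transitivity (iint k.+1 (fun=> 0 : \bar R)).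
  apply: eq_iint_ae => //.
  - by move=> d T zs mzs; exact: measurable_ball_ind mzs _.
  apply: filterS (ae_neq (0%R : R)) => a a0; apply: iaeT => z _.
  rewrite sqnorm_cons lt_geF// ltr_wpDr ?sqnorm_ge0//.
  by rewrite lt_neqAle sqr_ge0 eq_sym sqrf_eq0 andbT; exact/eqP.
by rewrite exprS mul0r iint0.
Qed.

Lemma iint_gauss k :
  iint k (fun z => (expR (- sqnorm z))%:E) = (Num.sqrt pi ^+ k : R)%:E.
Proof.
elim: k => [|k IH]; first by rewrite /= /sqnorm big_nil oppr0 expR0.
rewrite iintS.
transitivity (\int[mu]_a ((Num.sqrt pi ^+ k : R)%:E * (gauss_fun a)%:E)).
  apply: eq_integral => a _; rewrite muleC -IH -iintZl.
  - by apply: eq_iint => z _; rewrite sqnorm_cons opprD expRD.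
  - exact: gauss_fun_ge0.
  - by move=> z; rewrite lee_fin expR_ge0.
  - move=> d T zs mzs; apply/measurable_EFinP; apply: measurableT_comp => //.
    by apply: measurable_funN; exact: measurable_sqnorm mzs.
rewrite ge0_integralZl_EFin//.
- by rewrite integralT_gauss -EFinM exprSr.
- by move=> a _; rewrite lee_fin gauss_fun_ge0.
- by apply/measurable_EFinP; exact: measurable_gauss_fun.
Qed.

Lemma expR_layer_cake (q : R) :
  \int[mu]_t (((q <= t)%R%:R : R)%:E * (expR (- t))%:E) = (expR (- q))%:E.
Proof.
have mid : measurable_fun [set: R] (fun t : R => t) by exact: measurable_id.
have mf : measurable_fun [set: R] (fun t => ((q <= t)%R%:R : R)%:E * (expR (- t))%:E).
  apply: emeasurable_funM.
    by apply: measurable_bool_EFin; exact: measurable_fun_ler.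
  apply/measurable_EFinP; apply: measurableT_comp => //.
rewrite -(ge0_integral_shift q mf) => [|t]; last by rewrite mule_ge0 ?lee_fin// expR_ge0.
transitivity (\int[mu]_t ((expR (- q))%:E * (exponential_pdf 1 t)%:E)).
  apply: eq_integral => t _; rewrite /exponential_pdf patchE mem_setE in_itv/= andbT.
  rewrite lerDr; case: ifP => _; last by rewrite mul0e mule0.
  by rewrite mul1e mul1r mulN1r opprD expRD EFinM muleC.
rewrite ge0_integralZl_EFin ?expR_ge0//.
- by rewrite integral_exponential_pdf// mule1.
- by move=> t _; rewrite lee_fin exponential_pdf_ge0.
- by apply/measurable_EFinP; exact: measurable_exponential_pdf.
Qed.

Lemma powR_half (t : R) k : (0 <= t)%R -> (t `^ (k%:R / 2) = Num.sqrt t ^+ k)%R.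
Proof. by move=> t0; rewrite -powR12_sqrt// -powR_mulrn ?powR_ge0// -powRrM mulrC. Qed.

(* The integral defining Gamma (k / 2 + 1), before its finiteness is known. *)
Definition gamma_int k : \bar R :=
  \int[mu]_(t in `]0%R, +oo[) ((t `^ (k%:R / 2)) * expR (- t))%:E.

(** The Gaussian integral over R^k computed twice: as a product of line integrals, and by layers, as
    the integral of exp(- t) times the volume of the ball of squared radius t. *)
Lemma ballvol_gamma k : ballvol k 1 * gamma_int k = (Num.sqrt pi ^+ k : R)%:E.
Proof.
have mid : measurable_fun [set: R] (fun t : R => t) by exact: measurable_id.
have mexp : measurable_fun [set: R] (fun t : R => (expR (- t))%:E).
  by apply/measurable_EFinP; apply: measurableT_comp.
have mI : measurable (`]0%R, +oo[%classic : set R) by exact: measurable_itv.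
have mG : measurable_fun [set: R] (fun t : R => ((t `^ (k%:R / 2)) * expR (- t))%:E).
  apply/measurable_EFinP; apply: measurable_funM; first exact: measurable_powR.
  exact: measurableT_comp.
have G0 (t : R) : 0 <= ((t `^ (k%:R / 2)) * expR (- t))%:E.
  by rewrite lee_fin mulr_ge0 ?powR_ge0 ?expR_ge0.
have E0 (t : R) : 0 <= (expR (- t))%:E by rewrite lee_fin expR_ge0.
have mB := measurable_ballvol (R := R) k.
rewrite -iint_gauss.
transitivity (iint k (fun z => \int[mu]_t
    (((sqnorm z <= t)%R%:R : R)%:E * (expR (- t))%:E))); last first.
  by apply: eq_iint => z _; exact: expR_layer_cake.
rewrite -integral_iint; last 2 first.
- by move=> t z; rewrite mule_ge0 ?lee_fin.
- move=> d T phi zs mphi mzs; apply: emeasurable_funM.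
    exact: measurable_ball_ind mzs _.
  exact: (measurableT_comp mexp).
rewrite -ge0_integralZl//; last 2 first.
- exact: measurable_funTS.
- exact: ballvol_ge0.
transitivity (\int[mu]_t ((expR (- t))%:E * ballvol k t)); last first.
  apply: eq_integral => t _; rewrite ballvolE -iintZl ?expR_ge0//.
    by apply: eq_iint => z _; rewrite muleC.
  by move=> d T zs mzs; exact: measurable_ball_ind mzs _.
rewrite integral_mkcond; apply: ge0_ae_eq_integral => //.
- apply/(measurable_restrictT _ mI); apply: measurable_funTS.
  by apply: emeasurable_funM => //; exact: measurable_cst.
- exact: emeasurable_funM.
- by move=> t _; apply: erestrict_ge0 => ? _; rewrite mule_ge0// ballvol_ge0.
- by move=> t _; rewrite mule_ge0// ballvol_ge0.
apply: filterS (ae_neq (0%R : R)) => t t0 _; rewrite patchE mem_setE in_itv/= andbT.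
case: ifPn => tp.
  have -> : ballvol k t = (t `^ (k%:R / 2))%:E * ballvol k 1.
    by rewrite powR_half ?ltW// -ballvol_scale ?sqrtr_gt0// sqr_sqrtr// ltW.
  by rewrite EFinM [RHS]muleA [in RHS]muleC [X in _ * X]muleC.
have tn : (t < 0)%R by rewrite lt_neqAle leNgt tp andbT; exact/eqP.
by rewrite ballvol_lt0 ?mule0.
Qed.

Lemma GammaE k : Gamma (k%:R / 2 + 1 : R)%R = fine (gamma_int k).
Proof. by rewrite /Gamma /Rintegral /gamma_int addrK. Qed.

(** A product of two nonnegative extended reals that is finite and positive has finite positive
    factors, so [ballvol_gamma] alone yields the convergence of both integrals. *)
Lemma ballvol_gamma_pos k : exists u G : R, [/\ ballvol k 1 = u%:E, gamma_int k = G%:E,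
  (0 < u)%R & (0 < G)%R].
Proof.
have := ballvol_gamma k.
have p0 : (0 < Num.sqrt pi ^+ k :> R)%R by rewrite exprn_gt0// sqrtr_gt0 pi_gt0.
have : 0 <= gamma_int k.
  by apply: integral_ge0 => t _; rewrite lee_fin mulr_ge0 ?powR_ge0 ?expR_ge0.
have := ballvol_ge0 k (1 : R).
case: (ballvol k 1) => [u| |]//; case: (gamma_int k) => [G| |]//.
- rewrite !lee_fin => u0 G0 [uG]; exists u, G.
  have : u != 0%R by apply/eqP => E; move: p0; rewrite -uG E mul0r ltxx.
  have : G != 0%R by apply/eqP => E; move: p0; rewrite -uG E mulr0 ltxx.
  by move=> Gn un; split => //; rewrite lt_neqAle eq_sym ?un ?Gn.
- rewrite lee_fin le_eqVlt => /predU1P[<- _|u0 _]; first by rewrite mul0e => -[E]; rewrite E ltxx in p0.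
  by rewrite gt0_muley ?lte_fin.
- move=> _; rewrite lee_fin le_eqVlt => /predU1P[<-|G0]; first by rewrite mule0 => -[E]; rewrite E ltxx in p0.
  by rewrite gt0_mulye ?lte_fin.
Qed.

Lemma omega_gt0 k : (0 < omega R k)%R.
Proof.
have [u [G [_ GE _ G0]]] := ballvol_gamma_pos k.
by rewrite /omega GammaE GE divr_gt0// powR_gt0// pi_gt0.
Qed.

Lemma ballvol_omega k r : (0 <= r)%R -> ballvol k (r ^+ 2) = (r ^+ k * omega R k)%:E.
Proof.
have [u [G [uE GE u0 G0]]] := ballvol_gamma_pos k.
have Eu : omega R k = u.
  have := ballvol_gamma k; rewrite uE GE => -[uG].
  by rewrite /omega GammaE GE powR_half ?pi_ge0// -uG mulfK// gt_eqF.
rewrite le_eqVlt => /predU1P[<-|r0]; last by rewrite ballvol_scale// uE Eu.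
rewrite expr0n/= ballvol_at0; case: k {GE} uE Eu => [|k] uE ->; last by rewrite exprS !mul0r.
rewrite -[in RHS](mul1r u) !expr0 !mul1r -uE ballvolE /=.
by rewrite /sqnorm big_nil ler01.
Qed.

Lemma ballvol_fin k s : ballvol k s \is a fin_num.
Proof.
have [s0|s0] := leP 0%R s; last by rewrite ballvol_lt0.
by rewrite -[s]sqr_sqrtr// ballvol_omega// sqrtr_ge0.
Qed.

End ball_volume.

(** * The Steiner formula of the path simplex *)

Section index_sums.
Context {R : rcfType}.

Lemma big_ffun_recl (A : finType) k (F : {ffun 'I_k.+1 -> A} -> R) :
  \sum_f F f = \sum_(a : A) \sum_(g : {ffun 'I_k -> A})
    F [ffun i => if unlift ord0 i is Some j then g j else a].
Proof.
rewrite pair_big/=.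
rewrite (reindex (fun p : A * {ffun 'I_k -> A} =>
  [ffun i => if unlift ord0 i is Some j then p.2 j else p.1]))/=; last first.
  exists (fun f : {ffun 'I_k.+1 -> A} => (f ord0, [ffun j => f (lift ord0 j)])).
    move=> [a g] _ /=; rewrite ffunE unlift_none; congr pair.
    by apply/ffunP => j; rewrite !ffunE liftK.
  move=> f _; apply/ffunP => i; rewrite ffunE.
  by case: unliftP => [j ->|->]/=; rewrite ?ffunE.
by apply: eq_bigr => -[a g] _.
Qed.

(** The codomain bound [N] is separated from [n], because peeling off a coordinate lowers [n] while
    the type of the functions must stay fixed. *)
Lemma chain_sum_ffun N k n : (n <= N)%N ->
  \sum_(f : {ffun 'I_k -> 'I_N.+1} | [forall i, (1 <= f i)%N] && (\sum_(i < k) f i <= n)%N)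
    \prod_(i < k) (Num.sqrt (f i)%:R)^-1 = chain_sum k n :> R.
Proof.
elim: k n => [|k IH] n nN.
  rewrite big_mkcond (big_pred1 [ffun=> ord0])/=; last first.
    by move=> f; apply/esym/eqP/ffunP => -[].
  by rewrite !big_ord0 leq0n andbT ifT//; apply/forallP => -[].
rewrite big_mkcond big_ffun_recl big_ord_recl/= [X in X + _]big1 ?add0r; last first.
  move=> g _; rewrite ifF//; apply/negbTE; rewrite negb_and; apply/orP; left.
  by apply/forallPn; exists ord0; rewrite ffunE unlift_none.
rewrite /conv (big_ord_widen N (fun l => (root_succ l)^-1 * chain_sum k (n - l.+1)) nN).
rewrite [RHS]big_mkcond; apply: eq_bigr => l _.
have E (g : {ffun 'I_k -> 'I_N.+1}) (f := [ffun i => if unlift ord0 i is Some j then g j else lift ord0 l]) :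
    ([forall i, 0 < f i]%N = [forall i, 0 < g i]%N) *
    ((\sum_(i < k.+1) f i = l.+1 + \sum_(i < k) g i)%N) *
    (\prod_(i < k.+1) (Num.sqrt (f i)%:R)^-1 =
      (root_succ l)^-1 * \prod_(i < k) (Num.sqrt (g i)%:R)^-1 :> R).
  do !split.
  - apply/forallP/forallP => H i; first by have := H (lift ord0 i); rewrite ffunE liftK.
    by rewrite ffunE; case: unliftP.
  - rewrite big_ord_recl ffunE unlift_none; congr addn.
    by apply: eq_bigr => i _; rewrite ffunE liftK.
  - rewrite big_ord_recl ffunE unlift_none; congr (_ * _).
    by apply: eq_bigr => i _; rewrite ffunE liftK.
under eq_bigr do rewrite !E.
case: ifPn => ln; last first.
  by rewrite big1// => g _; rewrite ifF//; apply/negbTE; rewrite negb_and; lia.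
rewrite -IH; last by lia.
rewrite mulr_sumr -big_mkcond/=; apply: eq_bigl => g; congr (_ && _); lia.
Qed.

Lemma sum_index_set n k : \sum_(l in index_set n k)
  (Num.sqrt (\prod_(i < k) (l i)%:R))^-1 = chain_sum k n :> R.
Proof.
rewrite -(chain_sum_ffun k (leqnn n)); apply: eq_big => [l|l _]; first by rewrite inE.
rewrite prodfV; congr (_^-1).
elim/big_rec2: _ => [|i y x _ IH]; first by rewrite sqrtr1.
by rewrite sqrtrM// IH.
Qed.

End index_sums.

Section simplex.
Context {R : realType}.

Definition row_of_seq n (s : seq R) : 'rV[R]_n := \row_(i < n) s`_i.

(** The product measure is by definition the integral of the measures of sections, so this needs no
    measurability of [P]. *)
Lemma tuple_lebesgue_iint n (P : seq R -> Prop) :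
  tuple_lebesgue [set t : n.-tuple (measurableTypeR R) | P t] =
  iint n (fun s => (`[< P s >]%:R)%:E).
Proof.
elim: n P => [|n IH] P /=.
  by rewrite diracE.
rewrite /pushforward /product_measure1; apply: eq_integral => x _.
rewrite -IH /=; congr tuple_lebesgue.
by apply/seteqP; split => t; rewrite /xsection/= inE.
Qed.

Lemma vol_iint n (A : set 'rV[R]_n) :
  vol A = iint n (fun s => (`[< A (row_of_seq n s) >]%:R)%:E).
Proof.
rewrite -tuple_lebesgue_iint /vol; congr tuple_lebesgue.
apply/funext => t /=; congr A; apply/rowP => i.
by rewrite !mxE (tnth_nth 0).
Qed.

Lemma path_simplexP n (s : seq R) : size s = n ->
  path_simplex (row_of_seq n s) <-> monotone01 s.
Proof.
move=> sn; split=> [[w [w0 w1 E]]|/andP[/(pairwiseP 0) ds /allP s01]].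
  have sE i : (i < n)%N -> s`_i = \sum_(t < n.+1) w t * (i < t)%N%:R.
    move=> i_n; have /rowP/(_ (Ordinal i_n)) := E.
    by rewrite mxE summxE/= => ->; apply: eq_bigr => t _; rewrite !mxE.
  apply/andP; split.
    apply/(pairwiseP 0) => i j; rewrite !inE sn => i_n j_n ij.
    rewrite /= !sE//; apply: ler_sum => t _; apply: ler_wpM2l => //.
    by rewrite ler_nat; lia.
  apply/allP => _ /(nthP 0)[i + <-]; rewrite sn => i_n; rewrite sE//.
  rewrite sumr_ge0/= => [|t _]; last by rewrite mulr_ge0.
  rewrite -[leRHS]w1; apply: ler_sum => t _.
  by case: (i < t)%N; rewrite ?mulr1 ?mulr0.
(* The barycentric coordinates are the successive drops of 1, s_0, ..., s_(n-1), 0, the final 0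
   being the default value of [nth]. *)
pose e i := if i is j.+1 then s`_j else 1.
have s01' i : (i < n)%N -> 0 <= s`_i <= 1.
  by move=> i_n; apply: s01; rewrite mem_nth// sn.
have sN : s`_n = 0 by rewrite nth_default// sn.
have tele a : (a <= n.+1)%N -> \sum_(a <= i < n.+1) (e i - e i.+1) = e a - e n.+1.
  move=> an; rewrite (@telescope_sumr_eq _ _ _ (fun i => - e i))// => [|i _].
    by rewrite opprK addrC.
  by rewrite opprK addrC.
exists (fun i => e i - e i.+1); split.
- move=> -[[|i] ilt]; rewrite /e/= subr_ge0.
    have [n0|n0] := posnP n; first by rewrite nth_default ?sn ?n0.
    by case/andP: (s01' _ n0).
  have [iN|iN] := ltnP i.+1 n; first by apply: ds; rewrite ?inE ?sn; lia.
  rewrite [s`_i.+1]nth_default ?sn//.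
  by case/andP: (s01' i ilt).
- by rewrite -(big_mkord xpredT (fun i => e i - e i.+1)) (tele 0%N)// /e sN subr0.
- apply/rowP => j; rewrite mxE summxE.
  under eq_bigr do rewrite !mxE.
  rewrite -(big_mkord xpredT (fun i => (e i - e i.+1) * (j < i)%N%:R)).
  have jn := ltn_ord j.
  rewrite (big_cat_nat _ (n := j.+1))//=; last by lia.
  rewrite big_nat big1 ?add0r; last first.
    by move=> i /andP[_ ij]; rewrite ltnNge -ltnS ij mulr0.
  rewrite (eq_big_nat _ _ (F2 := fun i => e i - e i.+1)); last first.
    by move=> i /andP[ji _]; rewrite ji mulr1.
  by rewrite tele /e ?sN ?subr0//; lia.
Qed.

(** The sum over [j == i] reads the coordinate at a natural number [i] without a proof that
    [i < n]. *)
Lemma row_of_seqK n (x : 'rV[R]_n) : row_of_seq n (mkseq (fun i => \sum_(j < n | (j == i :> nat)) x 0 j) n) = x.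
Proof.
apply/rowP => i; rewrite mxE nth_mkseq// (bigD1 i)//= big1 ?addr0// => j /andP[/eqP/val_inj ->].
by rewrite eqxx.
Qed.

Lemma cost_sum n (s k : seq R) : size s = n -> size k = n ->
  cost s k = \sum_(i < n) (s`_i - k`_i) ^+ 2.
Proof.
move=> sn kn; rewrite /cost (big_nth (0, 0)) size_zip sn kn minnn big_mkord.
by apply: eq_bigr => i _; rewrite nth_zip ?sn ?kn.
Qed.

Lemma parallel_bodyP n (s : seq R) (r : R) : size s = n -> 0 <= r ->
  parallel_body (@path_simplex R n) r (row_of_seq n s) <-> near_simplex s (r ^+ 2).
Proof.
move=> sn r0; split=> [[x Kx [y By E]]|[k [ks K01 ck]]].
  pose k := mkseq (fun i => \sum_(j < n | (j == i :> nat)) x 0 j) n.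
  have kn : size k = n by rewrite size_mkseq.
  have xE : row_of_seq n k = x by exact: row_of_seqK.
  exists k; split; first by rewrite kn sn.
    by apply/(path_simplexP kn); rewrite xE.
  rewrite (cost_sum sn kn).
  have -> : \sum_(i < n) (s`_i - k`_i) ^+ 2 = r ^+ 2 * \sum_(i < n) y 0 i ^+ 2.
    rewrite mulr_sumr; apply: eq_bigr => i _.
    have /rowP/(_ i) := E; rewrite -xE !mxE => <-.
    by rewrite addrAC subrr add0r exprMn.
  have S0 : 0 <= \sum_(i < n) y 0 i ^+ 2 by apply: sumr_ge0 => i _; exact: sqr_ge0.
  rewrite ler_piMr ?sqr_ge0//; move: By; rewrite /eball/= /enorm => By.
  by rewrite -[leLHS]sqr_sqrtr// expr_le1// sqrtr_ge0.
rewrite sn in ks; rewrite (cost_sum sn ks) in ck.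
exists (row_of_seq n k); first exact/path_simplexP.
(* For [r = 0] the inverse is 0 and this is the zero vector, which works because a cost at most 0
   forces [s] and [k] to agree. *)
exists (r^-1 *: (row_of_seq n s - row_of_seq n k)); last first.
  have [r00|rn0] := eqVneq r 0; last first.
    by rewrite scalerA mulfV// scale1r addrC subrK.
  rewrite r00 scale0r addr0; apply/rowP => i; rewrite !mxE.
  move: ck; rewrite r00 expr0n/= => ck.
  have : \sum_(i < n) (s`_i - k`_i) ^+ 2 == 0.
    by rewrite eq_le ck sumr_ge0// => j _; exact: sqr_ge0.
  rewrite psumr_eq0 => [/allP/(_ i)|j _]; last exact: sqr_ge0.
  by rewrite mem_index_enum sqrf_eq0 subr_eq0 => /(_ isT)/eqP.
rewrite /eball/= /enorm.
have -> : \sum_(i < n) (r^-1 *: (row_of_seq n s - row_of_seq n k)) 0 i ^+ 2 =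
    (r^-1) ^+ 2 * \sum_(i < n) (s`_i - k`_i) ^+ 2.
  by rewrite mulr_sumr; apply: eq_bigr => i _; rewrite !mxE exprMn.
have [->|rn0] := eqVneq r 0; first by rewrite invr0 expr0n mul0r sqrtr0 ler01.
rewrite -[leRHS]sqrtr1; apply: ler_wsqrtr; rewrite exprVn mulrC ler_pdivrMr ?mul1r//.
by rewrite exprn_gt0// lt_neqAle eq_sym rn0.
Qed.

Lemma path_simplex_steiner n :
  steiner_formula (@path_simplex R n) [ffun j : 'I_n.+1 => steiner_coef n j].
Proof.
move=> r r0; rewrite vol_iint.
transitivity (nearvol n (r ^+ 2)).
  apply: eq_iint => s sn; congr (_%:R%:E); congr nat_of_bool.
  exact: (asbool_equiv_eq (parallel_bodyP sn r0)).
rewrite nearvol_expansion; last by move=> *; exact: ballvol_fin.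
rewrite -sumEFin; apply: eq_bigr => k _.
by rewrite ballvol_omega// ffunE -EFinM mulrC.
Qed.

(** The difference of the two formulas is a polynomial of degree at most [n] in [r] that vanishes at
    0, ..., n; its coefficients are differences of [V] and [W] in reverse order, times the positive
    [omega]. *)
Lemma steiner_formula_inj n (L : set 'rV[R]_n) (V W : {ffun 'I_n.+1 -> R}) :
  steiner_formula L V -> steiner_formula L W -> V = W.
Proof.
move=> HV HW.
pose c (i : nat) := omega R i * (V (inord (n - i)) - W (inord (n - i))).
pose p := \poly_(i < n.+1) c i.
have p0 r : 0 <= r -> root p r.
  move=> r0; have := HV r r0; rewrite (HW r r0) => -[] E.
  apply/rootP; rewrite horner_poly (reindex_inj rev_ord_inj)/=.
  rewrite -[RHS](subrr (\sum_(j < n.+1) r ^+ (n - j) * omega R (n - j) * V j)) -{2}E -sumrB.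
  apply: eq_bigr => j _; have jn : (j <= n)%N by rewrite -ltnS.
  by rewrite /c subSS subKn// inord_val -mulrBr mulrC mulrA.
have {}p0 : p = 0.
  apply: (@roots_geq_poly_eq0 _ p [seq i%:R | i <- iota 0 n.+1]).
  - by apply/allP => _ /mapP[i _ ->]; apply: p0.
  - by rewrite map_inj_uniq ?iota_uniq// => i j /eqP; rewrite eqr_nat => /eqP.
  - by rewrite size_map size_iota size_poly.
apply/ffunP => j; have jn : (j <= n)%N by rewrite -ltnS.
have /polyP/(_ (n - j)%N) := p0.
rewrite coef0 coef_poly ltnS leq_subr /c subKn// inord_val => /eqP.
by rewrite mulf_eq0 gt_eqF ?omega_gt0//= subr_eq0 => /eqP.
Qed.

End simplex.

Theorem theorem2 (R : realType) (n : nat) (hn : (1 <= n)%N)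
    (k : 'I_n.+1) (hk : (1 <= k)%N) :
  intrinsic_volume (@path_simplex R n) k =
  (k`!%:R)^-1 *
  \sum_(l in index_set n k) (Num.sqrt (\prod_(i < k) (l i)%:R))^-1.
Proof.
rewrite /intrinsic_volume.
(* The default branch contradicts the existence of a Steiner formula; in the other, uniqueness
   identifies the chosen [V]. *)
case: xgetP => [V _ HV|/(_ _ (@path_simplex_steiner R n))//].
rewrite (steiner_formula_inj HV (@path_simplex_steiner R n)) ffunE.
by rewrite /steiner_coef sum_index_set.
Qed.
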